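(* There exists a constant $C'$ such that, for all $n\ge 3$, $$\mathbb{E}\sup_{p \in [0, 1]}\left|\lambda_{p} - \mathbb{E}\lambda_{p}\right| \le C'\sqrt{\log \log n}.$$
   Context: For a positive integer $n$, let $(U_{i,j})_{1\le i<j\le n}$ be independent random variables uniformly distributed on $[0,1]$. For $p\in[0,1]$, the adjacency matrix $A_p$ of the Erdős–Rényi random graph $G(n,p)$ is the symmetric $n\times n$ matrix with zero diagonal and with entries $A^{(p)}_{i,j}=A^{(p)}_{j,i}=\mathbf{1}_{U_{i,j}<p}$ for $1\le i<j\le n$. All matrices $A_p$, $p\in[0,1]$, are built from the same variables $U_{i,j}$ (the Erdős–Rényi random graph process). $\lambda_p$ denotes the largest eigenvalue of $A_p$, which equals the spectral norm $\|A_p\|$. $\log$ is the natural logarithm. The constant $C'$ is universal (independent of $n$). *)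

(* Defs.v *)
From mathcomp Require Import all_boot all_order all_algebra.
From mathcomp Require Import all_classical all_reals all_analysis.

Set Implicit Arguments.
Unset Strict Implicit.
Unset Printing Implicit Defensive.

Import Order.TTheory GRing.Theory Num.Theory.
Import numFieldNormedType.Exports.

Local Open Scope classical_set_scope.
Local Open Scope ring_scope.

(* Both laws are compared on Borel sets only: [distribution P X] is a bare set
   function, unconstrained on non-measurable sets. *)
Definition uniform01 (d : measure_display) (T : measurableType d)
    (R : realType) (P : probability T R) (X : {RV P >-> R}) : Prop :=
  forall B : set R, measurable B ->
    distribution P X B = uniform_prob (@ltr01 R) B.

Definition mutually_independent (d : measure_display) (T : measurableType d)
    (R : realType) (P : probability T R) (I : finType) (D : {set I})
    (X : I -> {RV P >-> R}) : Prop :=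
  forall (J : {set I}) (B : I -> set R),
    J \subset D ->
    (forall i, i \in J -> measurable (B i)) ->
    P (\bigcap_(i in [set` J]) (X i @^-1` B i)) =
    (\prod_(i in J) P (X i @^-1` B i))%E.

Definition upper_pairs (n : nat) : {set 'I_n * 'I_n} :=
  [set e : 'I_n * 'I_n | (e.1 < e.2)%N]%SET.

(* Only the entries [u i j] with [i < j] are read. *)
Definition er_adjacency (R : realType) (n : nat) (u : 'I_n -> 'I_n -> R)
    (p : R) : 'M[R]_n :=
  \matrix_(i, j) (if (i < j)%N then (u i j < p)%R%:R
                  else if (j < i)%N then (u j i < p)%R%:R
                  else 0).

(* For a symmetric real matrix of positive size the set of eigenvalues is finite
   and nonempty, so that this supremum is a maximum. *)
Definition largest_eigenvalue (R : realType) (n : nat) (A : 'M[R]_n) : R :=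
  sup [set a : R | eigenvalue A a].

Definition er_lambda (d : measure_display) (T : measurableType d)
    (R : realType) (P : probability T R) (n : nat)
    (U : 'I_n -> 'I_n -> {RV P >-> R}) (p : R) (w : T) : R :=
  largest_eigenvalue (er_adjacency (fun i j => U i j w) p).

(* Main.v *)
Require Import Defs.
From mathcomp Require Import all_boot all_order all_algebra.
From mathcomp Require Import all_classical all_reals all_analysis.
From mathcomp Require Import measurable_realfun ring lra zify.

Set Implicit Arguments.
Unset Strict Implicit.
Unset Printing Implicit Defensive.

Import Order.TTheory GRing.Theory Num.Theory.
Import numFieldNormedType.Exports.

Local Open Scope ring_scope.

(* Write N for the number of vertices. Since p |-> lambda_p is nondecreasing, it
   suffices to control lambda_p on finite grids of values of p.

   Dense regime, N p >= C (log N)^2: on the event ||A_p - E A_p|| <= N p / 4,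
   expanding the quadratic form of A_p along the all-ones vector gives
   |lambda_p - N p| <= C + C |S_p| / N + X_p^2, where S_p is the centered number
   of edges and X_p, a normalized sum over cherries, has second moment O(1/N), so
   that the X_p^2 can be summed over a grid of O(N) points. The variables S_p / N
   are controlled uniformly by dyadic chaining with fourth moments, and the
   exceptional events by the expected trace of a power of A_p - E A_p of order
   log N. The supremum over this regime has bounded expectation.

   Sparse regime: there E lambda_p ranges over an interval of length O((log N)^2),
   hence a grid with O((log N)^2) points suffices, and each lambda_p is
   sub-Gaussian because lambda is a convex Lipschitz function of the edges
   (Maurey's infimum-convolution inequality). The union bound over this grid costs
   sqrt(log log N). *)

(** * Rayleigh quotients *)

(** The mean of lambda_p runs from 0 to about N, so one grid with bounded gaps would have about N
    points, and sub-Gaussian tails over it would cost sqrt(log N); this forces the two regimes.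
    Their border comes from a crude walk count: the expected trace of the 2k-th power of A_p - E A_p
    is at most N (k+1)^(2k+2) (N p)^k. Compared with (N p / 4)^(2k), this leaves (16 (k+1)^2 / (N
    p))^k up to factors polynomial in N and k, which is small enough once N p is a large multiple of
    k^2 with k of order log N. The power of log N at the border affects only the constant in front
    of sqrt(log log N).

    Maxima and exceptional events are never treated through probabilities. Each is replaced by a
    pointwise bound made of nonnegative functions of a configuration: |x| <= c + x^4 / c^3 in the
    chaining, x <= B + c exp(s x) on the sparse grid, and N times a normalized trace for a large
    norm. They add up to one function [H] that dominates the deviation for all p at once and whose
    mean is a sum of finite Bernoulli averages. *)

Lemma discriminant_le (R : realFieldType) (a b c : R) : 0 <= c ->
  (forall t, 0 <= a + t * b *+ 2 + t ^+ 2 * c) -> b ^+ 2 <= a * c.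
Proof.
move=> c_ge0 h; have [c0|c0] := eqVneq c 0; last first.
  have := h (- b / c).
  have -> : a + - b / c * b *+ 2 + (- b / c) ^+ 2 * c = (a * c - b ^+ 2) / c.
    by rewrite mulr2n; field.
  by rewrite pmulr_lge0 ?invr_gt0 ?lt_def ?c0// subr_ge0.
rewrite c0 mulr0; have [->|b0] := eqVneq b 0; first by rewrite expr0n.
have := h (- (a + 1) / (b *+ 2)).
rewrite c0 mulr0 addr0.
have -> : a + - (a + 1) / (b *+ 2) * b *+ 2 = - 1.
  by rewrite -mulr_natr -[b *+ 2]mulr_natr; field; rewrite b0.
by rewrite ler0N1.
Qed.

Section quadratic_forms.
Variables (R : realType) (n : nat).
Implicit Types (u v w x y z : 'rV[R]_n) (A B W : 'M[R]_n).

Definition dotv u v : R := \sum_i u 0 i * v 0 i.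

Lemma dotvE u v : dotv u v = (u *m v^T) 0 0.
Proof. by rewrite mxE; apply: eq_bigr => i _; rewrite mxE. Qed.

Lemma dotvC u v : dotv u v = dotv v u.
Proof. by apply: eq_bigr => i _; rewrite mulrC. Qed.

Lemma dotvDl u v w : dotv (u + v) w = dotv u w + dotv v w.
Proof. by rewrite -big_split; apply: eq_bigr => i _; rewrite mxE mulrDl. Qed.

Lemma dotvZl a u w : dotv (a *: u) w = a * dotv u w.
Proof. by rewrite mulr_sumr; apply: eq_bigr => i _; rewrite mxE mulrA. Qed.

Lemma dotvDr u v w : dotv w (u + v) = dotv w u + dotv w v.
Proof. by rewrite dotvC dotvDl !(dotvC w). Qed.

Lemma dotvZr a u w : dotv w (a *: u) = a * dotv w u.
Proof. by rewrite dotvC dotvZl dotvC. Qed.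

Lemma dotvNl u w : dotv (- u) w = - dotv u w.
Proof. by rewrite -scaleN1r dotvZl mulN1r. Qed.

Lemma dotv_ge0 u : 0 <= dotv u u.
Proof. by apply: sumr_ge0 => i _; rewrite -expr2 sqr_ge0. Qed.

Lemma dotv_eq0 u : (dotv u u == 0) = (u == 0).
Proof.
apply/idP/eqP => [|->]; last by rewrite /dotv big1// => i _; rewrite mxE mul0r.
rewrite psumr_eq0 => [/allP h|i _]; last by rewrite -expr2 sqr_ge0.
apply/rowP => i; rewrite mxE; apply/eqP.
by have := h i (mem_index_enum _); rewrite /= mulf_eq0 orbb.
Qed.

Lemma dotv0 : dotv 0 0 = 0.
Proof. by apply/eqP; rewrite dotv_eq0. Qed.

Lemma dotv_gt0 u : u != 0 -> 0 < dotv u u.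
Proof. by move=> u0; rewrite lt_def dotv_eq0 u0 dotv_ge0. Qed.

Lemma dotv_mulmx u A v : dotv (u *m A) v = dotv u (v *m A^T).
Proof. by rewrite !dotvE trmx_mul trmxK mulmxA. Qed.

Lemma dotv_sym A u v : A^T = A -> dotv (u *m A) v = dotv (v *m A) u.
Proof. by move=> hA; rewrite dotv_mulmx hA dotvC. Qed.

Lemma psd_cauchy_schwarz B u v : B^T = B ->
    (forall w, 0 <= dotv (w *m B) w) ->
  dotv (u *m B) v ^+ 2 <= dotv (u *m B) u * dotv (v *m B) v.
Proof.
move=> sB pB; apply: discriminant_le => // t.
have := pB (u + t *: v).
rewrite mulmxDl -scalemxAl !(dotvDl, dotvDr, dotvZl, dotvZr) (dotv_sym v u sB).
by rewrite -mulr_natr; lra.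
Qed.

Lemma dotv_cauchy_schwarz u v : dotv u v ^+ 2 <= dotv u u * dotv v v.
Proof.
rewrite -{1}[u]mulmx1 -{2}[u]mulmx1 -{2}[v]mulmx1.
by apply: psd_cauchy_schwarz => [|w]; rewrite ?trmx1 ?mulmx1 ?dotv_ge0.
Qed.

(** The squared Frobenius norm dominates the squared operator norm: Cauchy-Schwarz in each column of
    [A]. *)
Lemma dotv_mulmx_le u A :
  dotv (u *m A) (u *m A) <= \tr (A^T *m A) * dotv u u.
Proof.
rewrite {1}/dotv /mxtrace mulr_suml; apply: ler_sum => j _.
rewrite !mxE -expr2.
have -> : \sum_k u 0 k * A k j = dotv u (row j A^T).
  by apply: eq_bigr => k _; rewrite !mxE.
apply: le_trans (dotv_cauchy_schwarz _ _) _.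
rewrite mulrC ler_wpM2r ?dotv_ge0//.
by apply: ler_sum => i _; rewrite !mxE.
Qed.

End quadratic_forms.

Section largest_eigenvalue.
Variables (R : realType) (n : nat).
Implicit Types (u v w x y z : 'rV[R]_n.+1) (A B W : 'M[R]_n.+1).

(* If [B = s - A] were invertible, Cauchy-Schwarz for the semidefinite form [B]
   would bound it away from 0 on the unit sphere. *)
Lemma rayleigh_sup_is_eigenvalue A (s : R) : A^T = A ->
    (forall v, dotv (v *m A) v <= s * dotv v v) ->
    (forall e, 0 < e -> exists2 v, dotv v v = 1 & s - e < dotv (v *m A) v) ->
  eigenvalue A s.
Proof.
move=> sA sub slub; pose B := s%:M - A.
have sB : B^T = B by rewrite /B linearB /= tr_scalar_mx sA.
have qB v : dotv (v *m B) v = s * dotv v v - dotv (v *m A) v.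
  by rewrite /B mulmxBr dotvDl dotvNl mul_mx_scalar dotvZl.
have pB v : 0 <= dotv (v *m B) v by rewrite qB subr_ge0.
have [/negP|nuB] := boolP (B \in unitmx); last first.
  move: nuB; rewrite -row_free_unit -kermx_eq0 => kB.
  rewrite /eigenvalue /eigenspace.
  have -> : A - s%:M = - B by rewrite opprB.
  apply: contraNN kB => /eqP k0.
  have : kermx B *m (- B) = 0 by rewrite mulmxN mulmx_ker oppr0.
  by move/sub_kermxP; rewrite k0 submx0.
case=> uB.
(* Squared Frobenius norms of the inverse of [B] and of [B]. Below, [L + 1] stands in for the square
   root of [L] as a bound on the operator norm of [B]. *)
pose K := \tr ((invmx B)^T *m invmx B); pose L := \tr (B^T *m B).
have K0 : 0 <= K.
  by apply: sumr_ge0 => i _; rewrite mxE; apply: sumr_ge0 => j _;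
     rewrite mxE -expr2 sqr_ge0.
have L0 : 0 <= L.
  by apply: sumr_ge0 => i _; rewrite mxE; apply: sumr_ge0 => j _;
     rewrite mxE -expr2 sqr_ge0.
have key v : dotv v v = 1 -> 1 <= K * (L + 1) * dotv (v *m B) v.
  move=> v1.
  have h1 : 1 <= K * dotv (v *m B) (v *m B).
    by rewrite -v1 -{1 2}[v](mulmxK uB) dotv_mulmx_le.
  apply: le_trans h1 _; rewrite -mulrA ler_wpM2l//.
  set y := v *m B; set b := dotv y y.
  have h2 : dotv (y *m B) y <= (L + 1) * b.
    have hr : 0 <= (L + 1) * b by rewrite mulr_ge0 ?dotv_ge0 ?addr_ge0.
    rewrite -ler_sqr ?nnegrE ?pB//.
    apply: le_trans (dotv_cauchy_schwarz _ _) _.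
    apply: le_trans (ler_wpM2r (dotv_ge0 _) (dotv_mulmx_le _ _)) _.
    rewrite -/L -/b; have := dotv_ge0 y; rewrite -/b => b0.
    have : 0 <= b ^+ 2 by rewrite sqr_ge0.
    nra.
  have h3 : b ^+ 2 <= dotv y v * ((L + 1) * b).
    apply: le_trans (psd_cauchy_schwarz v y sB pB) _.
    by rewrite ler_wpM2l ?pB.
  have [b0|b0] := eqVneq b 0.
    by rewrite b0 mulr_ge0 ?addr_ge0// pB.
  have bgt0 : 0 < b by rewrite lt_def b0 dotv_ge0.
  rewrite -(ler_pM2r bgt0) -expr2; apply: le_trans h3 _.
  by rewrite [leRHS]mulrAC mulrC.
have [v v1 hv] := slub ((2 * (K * (L + 1) + 1))^-1)
  ltac:(by rewrite invr_gt0 mulr_gt0// ltr_wpDl// mulr_ge0// addr_ge0).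
have := key v v1; rewrite qB v1 mulr1.
set c := K * (L + 1); set q := dotv _ _ in hv *.
have c0 : 0 <= c by rewrite mulr_ge0// addr_ge0.
have : c * (s - q) <= c * (2 * (c + 1))^-1.
  by rewrite ler_wpM2l// lerBlDr -lerBlDl ltW.
have : c * (2 * (c + 1))^-1 < 1.
  by rewrite ltr_pdivrMr; lra.
lra.
Qed.

(** Crude, but it makes the Rayleigh quotients bounded, so that their supremum exists. *)
Lemma dotv_mulmx_bound A v :
  `|dotv (v *m A) v| <= (\sum_i \sum_j `|A i j|) * dotv v v.
Proof.
have -> : dotv (v *m A) v = \sum_i \sum_j v 0 i * A i j * v 0 j.
  rewrite exchange_big; apply: eq_bigr => j _ /=.
  by rewrite mxE mulr_suml.
apply: le_trans (ler_norm_sum _ _ _) _; rewrite mulr_suml; apply: ler_sum => i _.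
apply: le_trans (ler_norm_sum _ _ _) _; rewrite mulr_suml; apply: ler_sum => j _.
rewrite !normrM mulrAC mulrC ler_wpM2l//.
have hk k : `|v 0 k| ^+ 2 <= dotv v v.
  rewrite real_normK ?num_real// /dotv (bigD1 k)//= -expr2 lerDl.
  by apply: sumr_ge0 => l _; rewrite -expr2 sqr_ge0.
have := hk i; have := hk j; have := sqr_ge0 (`|v 0 i| - `|v 0 j|); nra.
Qed.

Lemma eigenvalue_rayleigh A a : eigenvalue A a ->
  exists2 v, dotv v v = 1 & v *m A = a *: v.
Proof.
case/eigenvalueP => v va v0; exists ((Num.sqrt (dotv v v))^-1 *: v).
  rewrite dotvZl dotvZr mulrA -expr2 exprVn sqr_sqrtr ?dotv_ge0//.
  by rewrite mulVf// dotv_eq0.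
by rewrite -scalemxAl va !scalerA mulrC.
Qed.

(** The supremum of the Rayleigh quotients is an eigenvalue by [rayleigh_sup_is_eigenvalue], hence
    attained at a unit eigenvector. Conversely each eigenvalue is a Rayleigh quotient, so the two
    suprema coincide. *)
Lemma largest_eigenvalueP A : A^T = A ->
  (forall v, dotv (v *m A) v <= largest_eigenvalue A * dotv v v) /\
  (exists2 v, dotv v v = 1 & dotv (v *m A) v = largest_eigenvalue A).
Proof.
move=> sA; pose S := [set dotv (v *m A) v | v in [set v | dotv v v = 1]]%classic.
pose e0 : 'rV[R]_n.+1 := delta_mx 0 0.
have e01 : dotv e0 e0 = 1.
  rewrite /dotv (bigD1 0)//= !mxE eqxx mulr1 big1 ?addr0// => i /negPf i0.
  by rewrite !mxE i0 andbF mul0r.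
have hS : has_sup S.
  split; first by exists (dotv (e0 *m A) e0); exists e0.
  exists (\sum_i \sum_j `|A i j|) => _ [v /= v1 <-].
  by apply: le_trans (ler_norm _) _; rewrite -[leRHS]mulr1 -v1 dotv_mulmx_bound.
have ub v : dotv (v *m A) v <= sup S * dotv v v.
  have [->|v0] := eqVneq v 0; first by rewrite mul0mx !dotv0 mulr0.
  pose c := (Num.sqrt (dotv v v))^-1.
  have cc : c * c * dotv v v = 1.
    by rewrite -expr2 exprVn sqr_sqrtr ?dotv_ge0// mulVf// dotv_eq0.
  rewrite -ler_pdivrMr ?dotv_gt0//.
  have -> : dotv (v *m A) v / dotv v v = dotv ((c *: v) *m A) (c *: v).
    rewrite -scalemxAl dotvZl dotvZr mulrA [RHS]mulrC; congr (_ * _).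
    apply: (mulIf (_ : dotv v v != 0)); first by rewrite dotv_eq0.
    by rewrite cc mulVf// dotv_eq0.
  by apply: sup_upper_bound => //; exists (c *: v); rewrite //= dotvZl dotvZr mulrA.
have eS : eigenvalue A (sup S).
  apply: rayleigh_sup_is_eigenvalue => // e egt0.
  by have [_ [v v1 <-] hv] := sup_adherent egt0 hS; exists v.
have leS a : eigenvalue A a -> a <= sup S.
  by case/eigenvalue_rayleigh => v v1 va; have := ub v; rewrite va dotvZl v1 !mulr1.
suff -> : largest_eigenvalue A = sup S.
  split => //; have [v v1 va] := eigenvalue_rayleigh eS.
  by exists v => //; rewrite va dotvZl v1 mulr1.
apply/eqP; rewrite eq_le; apply/andP; split.
  by apply: ge_sup; [exists (sup S) | move=> a /leS].
by apply: ub_le_sup => //; exists (sup S) => a /leS.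
Qed.

Lemma rayleigh_le A v : A^T = A ->
  dotv (v *m A) v <= largest_eigenvalue A * dotv v v.
Proof. by move/largest_eigenvalueP => []. Qed.

Lemma rayleigh_max A : A^T = A ->
  exists2 v, dotv v v = 1 & dotv (v *m A) v = largest_eigenvalue A.
Proof. by move/largest_eigenvalueP => []. Qed.

Lemma trmx_exp A k : (A ^+ k)^T = (A^T) ^+ k.
Proof.
elim: k => [|k ih]; first by rewrite !expr0 trmx1.
by rewrite exprS -[A * _]/(A *m _) trmx_mul ih exprSr.
Qed.

(* Cauchy-Schwarz gives [(z W^j z)^2 <= (z W^(2j) z) (z z)]; doubling [j] avoids
   the spectral theorem. *)
Lemma dotv_pow_le W z (s : nat) : W^T = W ->
  `|dotv (z *m W) z| ^+ (2 ^ s) <=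
  `|dotv (z *m W ^+ (2 ^ s)) z| * dotv z z ^+ (2 ^ s).-1.
Proof.
move=> sW; elim: s => [|s ih]; first by rewrite expn0 !expr1 expr0 mulr1.
set k := (2 ^ s)%N in ih *.
have k0 : (0 < k)%N by rewrite expn_gt0.
have -> : (2 ^ s.+1 = k * 2)%N by rewrite expnSr.
rewrite exprM.
have := ih; rewrite -ler_sqr ?nnegrE ?mulr_ge0 ?exprn_ge0 ?dotv_ge0//.
move=> /le_trans; apply; rewrite exprMn real_normK ?num_real//.
have sWk : (W ^+ k)^T = W ^+ k by rewrite trmx_exp sW.
have -> : dotv (z *m W ^+ (k * 2)) z = dotv (z *m W ^+ k) (z *m W ^+ k).
  by rewrite muln2 -addnn exprD -[X in z *m X]/(_ *m _) mulmxA dotv_mulmx sWk.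
rewrite [in leRHS]ger0_norm ?dotv_ge0//.
have -> : (k * 2).-1 = (k.-1 * 2).+1 by lia.
rewrite [in leRHS]exprS [in leRHS]exprM [in leRHS]mulrA ler_wpM2r ?sqr_ge0//.
exact: dotv_cauchy_schwarz.
Qed.

(** An even power [W ^+ (2 * k)] has as trace the squared Frobenius norm of [W ^+ k], which bounds
    its quadratic form; [dotv_pow_le] then descends to the form of [W] itself. *)
Lemma dotv_le_of_trace_pow W z (s : nat) (d : R) : W^T = W -> 0 <= d ->
    \tr (W ^+ (2 ^ s.+1)) <= d ^+ (2 ^ s.+1) ->
  `|dotv (z *m W) z| <= d * dotv z z.
Proof.
move=> sW d0 tW; have k0 : (0 < 2 ^ s.+1)%N by rewrite expn_gt0.
rewrite -(@ler_pXn2r _ (2 ^ s.+1))// ?nnegrE ?mulr_ge0 ?dotv_ge0//.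
apply: le_trans (dotv_pow_le _ _ sW) _.
have -> : (d * dotv z z) ^+ (2 ^ s.+1) =
    d ^+ (2 ^ s.+1) * dotv z z * dotv z z ^+ (2 ^ s.+1).-1.
  by rewrite exprMn -mulrA -exprS prednK.
rewrite ler_wpM2r ?exprn_ge0 ?dotv_ge0//.
apply: le_trans (ler_wpM2r (dotv_ge0 z) tW).
set k := (2 ^ s)%N.
have sWk : (W ^+ k)^T = W ^+ k by rewrite trmx_exp sW.
have WW : W ^+ (2 ^ s.+1) = W ^+ k *m W ^+ k.
  by rewrite expnSr muln2 -addnn exprD.
rewrite WW mulmxA dotv_mulmx sWk ger0_norm ?dotv_ge0//.
by rewrite -{3}sWk dotv_mulmx_le.
Qed.

End largest_eigenvalue.

(** * Maurey's inequality on the cube *)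

Section bernoulli_tuples.
Variable R : realType.

Lemma big_tuple_cons (V : nmodType) (T : finType) N (F : N.+1.-tuple T -> V) :
  \sum_t F t = \sum_x \sum_(t : N.-tuple T) F [tuple of x :: t].
Proof.
rewrite pair_big/=.
rewrite (reindex (fun q : T * N.-tuple T => [tuple of q.1 :: q.2]))//=.
exists (fun t => (thead t, [tuple of behead t])) => [[x t] _|t _] /=.
  by rewrite theadE; congr (_, _); apply: val_inj.
by rewrite [RHS]tuple_eta; apply: val_inj.
Qed.

Lemma big_tuple_nil (V : nmodType) (T : finType) (F : 0.-tuple T -> V) :
  \sum_t F t = F [tuple].
Proof. by rewrite (bigD1 [tuple])//= big1 ?addr0// => t /eqP[]; apply: tuple0. Qed.

Definition bern (p : R) (b : bool) : R := if b then p else 1 - p.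

Lemma bern_ge0 p b : 0 <= p <= 1 -> 0 <= bern p b.
Proof. by case: b => /=; lra. Qed.

(** Tuples allow induction on the number of coordinates; [bmeanE] transports the results to
    configurations indexed by edges. *)
Definition tmean p N (F : N.-tuple bool -> R) : R :=
  \sum_(t : N.-tuple bool) (\prod_(b <- t) bern p b) * F t.

Lemma tmean_nil p (F : 0.-tuple bool -> R) : tmean p F = F [tuple].
Proof. by rewrite /tmean big_tuple_nil big_nil mul1r. Qed.

Lemma tmean_cons p N (F : N.+1.-tuple bool -> R) :
  tmean p F = (1 - p) * tmean p (fun t => F [tuple of false :: t]) +
              p * tmean p (fun t => F [tuple of true :: t]).
Proof.
rewrite /tmean big_tuple_cons big_bool addrC /= !mulr_sumr.
by congr (_ + _); apply: eq_bigr => t _; rewrite big_cons mulrA.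
Qed.

Lemma tmean_weight_ge0 p (s : seq bool) : 0 <= p <= 1 ->
  0 <= \prod_(b <- s) bern p b.
Proof. by move=> hp; apply: prodr_ge0 => b _; apply: bern_ge0. Qed.

Lemma le_tmean p N (F G : N.-tuple bool -> R) : 0 <= p <= 1 ->
  (forall t, F t <= G t) -> tmean p F <= tmean p G.
Proof.
by move=> hp h; apply: ler_sum => t _; rewrite ler_wpM2l// tmean_weight_ge0.
Qed.

Lemma tmeanZ p N c (F : N.-tuple bool -> R) :
  tmean p (fun t => c * F t) = c * tmean p F.
Proof. by rewrite mulr_sumr; apply: eq_bigr => t _; rewrite mulrCA. Qed.

Lemma tmeanD p N (F G : N.-tuple bool -> R) :
  tmean p (fun t => F t + G t) = tmean p F + tmean p G.
Proof. by rewrite -big_split; apply: eq_bigr => t _; rewrite mulrDr. Qed.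

Lemma tmean_cst p N c : @tmean p N (fun=> c) = c.
Proof.
elim: N => [|N ih]; first by rewrite tmean_nil.
by rewrite tmean_cons ih -mulrDl subrK mul1r.
Qed.

Lemma expR_convex (x y t : R) : 0 <= t <= 1 ->
  expR ((1 - t) * x + t * y) <= (1 - t) * expR x + t * expR y.
Proof.
move=> t01; set m := (1 - t) * x + t * y.
have tangent z : expR m * (1 + (z - m)) <= expR z.
  rewrite (_ : expR z = expR m * expR (z - m)); last by rewrite -expRD subrKC.
  by rewrite ler_wpM2l ?expR_ge0 ?expR_ge1Dx.
have -> : expR m = (1 - t) * (expR m * (1 + (x - m))) +
                   t * (expR m * (1 + (y - m))).
  by rewrite /m; ring.
by rewrite lerD// ler_wpM2l//; lra.
Qed.

(** Hölder's inequality for exponentials. Dividing by the right-hand side normalizes both hypotheses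
    to means at most 1, and convexity of the exponential then applies pointwise. *)
Lemma tmean_expR_hoelder p N (F G : N.-tuple bool -> R) (a b t : R) :
    0 <= p <= 1 -> 0 <= t <= 1 ->
    tmean p (fun x => expR (F x)) <= expR a ->
    tmean p (fun x => expR (G x)) <= expR b ->
  tmean p (fun x => expR ((1 - t) * F x + t * G x)) <= expR ((1 - t) * a + t * b).
Proof.
move=> hp ht ha hb; set c := (1 - t) * a + t * b.
suff : tmean p (fun x => expR (- c) * expR ((1 - t) * F x + t * G x)) <= 1.
  by rewrite tmeanZ expRN mulrC ler_pdivrMr ?expR_gt0// mul1r.
pose H x := (1 - t) * (expR (- a) * expR (F x)) + t * (expR (- b) * expR (G x)).
apply: (@le_trans _ _ (tmean p H)).
  apply: le_tmean => // x; rewrite /H -!expRD.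
  have -> : - c + ((1 - t) * F x + t * G x) =
            (1 - t) * (- a + F x) + t * (- b + G x) by rewrite /c; ring.
  exact: expR_convex.
rewrite /H tmeanD !tmeanZ !expRN.
have h1 : (expR a)^-1 * tmean p (fun x => expR (F x)) <= 1.
  by rewrite mulrC ler_pdivrMr ?expR_gt0// mul1r.
have h2 : (expR b)^-1 * tmean p (fun x => expR (G x)) <= 1.
  by rewrite mulrC ler_pdivrMr ?expR_gt0// mul1r.
nra.
Qed.

Lemma expR_le_inv (x : R) : x < 1 -> expR x <= (1 - x)^-1.
Proof.
move=> x1; rewrite -[x in expR x]opprK expRN lef_pV2 ?posrE ?expR_gt0 ?subr_gt0//.
exact: expR_ge1Dx.
Qed.

(* The interpolation parameter is [3 d], truncated to 1. *)
Lemma two_point_aux (d : R) : 0 <= d ->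
  exists2 t, 0 <= t <= 1 & expR ((1 - t) * d + t ^+ 2 / 9) + expR (- d) <= 2.
Proof.
move=> d0.
(* By [expR_le_inv] the sum is at most 1/(1-q) + 1/(1+d), which is at most 2 exactly when q(1+2d) <=
   d. *)
have red q : 0 <= q -> q * (1 + 2 * d) <= d -> expR q + expR (- d) <= 2.
  move=> q0 hq; have q1 : q < 1 by nra.
  apply: le_trans (lerD (expR_le_inv q1) (expR_le_inv _)) _; first by lra.
  rewrite opprK -lerBrDr.
  have -> : 2 - (1 + d)^-1 = (1 + 2 * d) / (1 + d) by field; lra.
  rewrite ler_pdivlMr; last by lra.
  by rewrite mulrC ler_pdivrMr; lra.
have [hd|hd] := leP (3 * d) 1.
  exists (3 * d); first by lra.
  by apply: red; nra.
exists 1; first by lra.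
by apply: red; lra.
Qed.

(** By [two_point_aux] the two factors have sum at most 2, so AM-GM bounds their product by 1. *)
Lemma two_point_mono (p d : R) : 0 <= p <= 1 -> 0 <= d ->
  exists2 t, 0 <= t <= 1 &
    ((1 - p) + p * expR ((1 - t) * d + t ^+ 2 / 9)) *
    ((1 - p) + p * expR (- d)) <= 1.
Proof.
move=> p01 d0; have [t t01 ht] := two_point_aux d0; exists t => //.
set x := expR _ in ht *; set y := expR (- d) in ht *.
have x0 : 0 <= x by apply: expR_ge0.
have y0 : 0 <= y by apply: expR_ge0.
set a := 1 - p + _; set b := 1 - p + _.
have a0 : 0 <= a by rewrite addr_ge0 ?mulr_ge0//; lra.
have b0 : 0 <= b by rewrite addr_ge0 ?mulr_ge0//; lra.
have ab : a + b <= 2 by rewrite /a /b; nra.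
have := sqr_ge0 (a - b); nra.
Qed.

(** One-coordinate step of Maurey's inequality: [g0] and [g1] belong to the two slices, and [t.1],
    [t.2] say how far each slice interpolates towards the other, at cost t^2/9. Only the slice with
    the larger value moves; for the other the parameter is 0. *)
Lemma two_point (p g0 g1 : R) : 0 <= p <= 1 -> exists2 t : R * R,
    (0 <= t.1 <= 1) && (0 <= t.2 <= 1) &
  ((1 - p) * expR ((1 - t.1) * g0 + t.1 * g1 + t.1 ^+ 2 / 9) +
   p * expR ((1 - t.2) * g1 + t.2 * g0 + t.2 ^+ 2 / 9)) *
  ((1 - p) * expR (- g0) + p * expR (- g1)) <= 1.
Proof.
move=> p01; have [g01|/ltW g10] := leP g0 g1.
  have d0 : 0 <= g1 - g0 by rewrite subr_ge0.
  have [t t01 ht] := two_point_mono p01 d0; exists (0, t); first by rewrite t01 lexx ler01.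
  rewrite /= subr0 mul1r mul0r addr0 expr0n mul0r addr0.
  apply: le_trans ht; rewrite le_eqVlt; apply/orP; left; apply/eqP.
  have -> : (1 - t) * g1 + t * g0 + t ^+ 2 / 9 =
            g0 + ((1 - t) * (g1 - g0) + t ^+ 2 / 9) by ring.
  have -> : - g1 = - g0 + - (g1 - g0) by ring.
  rewrite !expRD expRN; field.
  by rewrite gt_eqF ?expR_gt0.
have d0 : 0 <= g0 - g1 by rewrite subr_ge0.
have q01 : 0 <= 1 - p <= 1 by lra.
have [t t01 ht] := two_point_mono q01 d0; exists (t, 0); first by rewrite t01 lexx ler01.
rewrite /= subr0 mul1r mul0r addr0 expr0n mul0r addr0.
apply: le_trans ht; rewrite le_eqVlt; apply/orP; left; apply/eqP.
have -> : (1 - t) * g0 + t * g1 + t ^+ 2 / 9 =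
          g1 + ((1 - t) * (g0 - g1) + t ^+ 2 / 9) by ring.
have -> : - g0 = - g1 + - (g0 - g1) by ring.
rewrite !expRD expRN; field.
by rewrite gt_eqF ?expR_gt0.
Qed.

Definition mix N (t : R) (x y : N.-tuple R) : N.-tuple R :=
  [tuple of [seq (1 - t) * z.1 + t * z.2 | z <- zip x y]].

Definition convex_tuple N (f : N.-tuple R -> R) :=
  forall t x y, 0 <= t <= 1 -> f (mix t x y) <= (1 - t) * f x + t * f y.

Definition sqdist (x : seq bool) (y : seq R) : R :=
  \sum_(z <- zip x y) ((z.1 : bool)%:R - z.2) ^+ 2.

Lemma sqdist_ge0 x y : 0 <= sqdist x y.
Proof. by apply: sumr_ge0 => z _; rewrite sqr_ge0. Qed.

Lemma sqdist_cons b x c y :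
  sqdist (b :: x) (c :: y) = (b%:R - c) ^+ 2 + sqdist x y.
Proof. by rewrite /sqdist big_cons. Qed.

Lemma sqdist_mix N (x : N.-tuple bool) (y z : N.-tuple R) t : 0 <= t <= 1 ->
  sqdist x (mix t y z) <= (1 - t) * sqdist x y + t * sqdist x z.
Proof.
move=> t01; rewrite /mix /=.
have : size (y : seq R) = size (z : seq R) by rewrite !size_tuple.
elim: (x : seq bool) (y : seq R) (z : seq R) => [|b s ih] [|c u] [|e v]//=.
- by rewrite /sqdist !big_nil !mulr0 addr0.
- by rewrite /sqdist !big_nil !mulr0 addr0.
- by rewrite /sqdist !big_nil !mulr0 addr0.
move=> [/ih h]; rewrite !sqdist_cons /=.
set B := b%:R; have := mulr_ge0 (mulr_ge0 (_ : 0 <= t) (_ : 0 <= 1 - t)) (sqr_ge0 (c - e)).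
by move=> /(_ ltac:(lra) ltac:(lra)); nra.
Qed.

(* Maurey's infimum convolution. With the cost constant [1 / 9] the two-point
   inequality needs only [1 + x <= exp x]. *)
Definition infconv N (f : N.-tuple R -> R) (x : seq bool) : R :=
  inf [set f y + sqdist x y / 9 | y in [set: N.-tuple R]]%classic.

Lemma infconv_le N (f : N.-tuple R -> R) x y : (forall y, 0 <= f y) ->
  infconv f x <= f y + sqdist x y / 9.
Proof.
move=> f0; apply: ge_inf; last by exists y.
by exists 0 => _ [z _ <-]; rewrite addr_ge0// divr_ge0// sqdist_ge0.
Qed.

Lemma le_infconv N (f : N.-tuple R -> R) x (t a b : R) : 0 <= t ->
    (forall y, a <= t * (f y + sqdist x y / 9) + b) ->
  a <= t * infconv f x + b.
Proof.
rewrite le_eqVlt => /predU1P[<-|t0] h.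
  by have := h [tuple of nseq N 0]; rewrite !mul0r.
rewrite -lerBlDr -ler_pdivrMl//.
apply: lb_le_inf.
  by eexists; exists [tuple of nseq N 0].
by move=> _ [y _ <-]; rewrite ler_pdivrMl// lerBlDr.
Qed.

(** Given competitors [y] and [z] for the two slices, their mixture with weight [t] competes for
    [f]. Convexity handles both [f] and the distance on the tail, and the first coordinate moves by
    at most [t], whence t^2/9. *)
Lemma infconv_cons N (f : N.+1.-tuple R -> R) (b c : bool) (x : N.-tuple bool) t :
    0 <= t <= 1 -> (forall y, 0 <= f y) -> convex_tuple f ->
  infconv f (b :: x) <=
    (1 - t) * infconv (fun y : N.-tuple R => f [tuple of b%:R :: y]) x +
    t * infconv (fun y : N.-tuple R => f [tuple of c%:R :: y]) x + t ^+ 2 / 9.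
Proof.
move=> t01 f0 cf; rewrite -addrA; apply: le_infconv => [|y]; first by lra.
rewrite addrCA; apply: le_infconv => [|z]; first by lra.
pose Y := [tuple of b%:R :: y]; pose Z := [tuple of c%:R :: z].
apply: le_trans (infconv_le _ (mix t Y Z) f0) _.
have -> : sqdist (b :: x) (mix t Y Z) =
    (b%:R - ((1 - t) * b%:R + t * c%:R)) ^+ 2 + sqdist x (mix t y z).
  by rewrite -sqdist_cons.
have := cf t Y Z t01; have := sqdist_mix x y z t01.
have : (b%:R - ((1 - t) * b%:R + t * c%:R)) ^+ 2 <= t ^+ 2 :> R.
  by case: b {Y Z}; case: c => /=; nra.
lra.
Qed.

Definition tuple_real N (x : N.-tuple bool) : N.-tuple R :=
  [tuple of [seq (b : bool)%:R | b <- x]].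

Lemma tmean_gt0 p N (F : N.-tuple bool -> R) : 0 <= p <= 1 ->
  (forall t, 0 < F t) -> 0 < tmean p F.
Proof.
move=> p01; elim: N F => [|N ih] F F0; first by rewrite tmean_nil.
rewrite tmean_cons.
have h1 := ih (fun t => F [tuple of false :: t]) (fun t => F0 _).
have h2 := ih (fun t => F [tuple of true :: t]) (fun t => F0 _).
have [p0|p0] := eqVneq p 0.
  by rewrite p0 in h1 *; rewrite subr0 mul1r mul0r addr0.
have : 0 < p by rewrite lt_def p0; case/andP: p01.
by move=> {p0} p0; nra.
Qed.

(** Tensorization. The induction hypothesis on the slice [b] bounds the exponential moment of its
    infimum convolution by exp(g b), where exp(- g b) is the slice mean of exp(- f). [infconv_cons]
    and Hölder interpolate between the slices, and [two_point] concludes for the first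
    coordinate. *)
Lemma maurey p N (f : N.-tuple R -> R) : 0 <= p <= 1 ->
    (forall y, 0 <= f y) -> convex_tuple f ->
  tmean p (fun x : N.-tuple bool => expR (infconv f x)) *
  tmean p (fun x => expR (- f (tuple_real x))) <= 1.
Proof.
move=> p01; elim: N f => [|N ih] f f0 cf.
  rewrite !tmean_nil -expRD expR_le1 subr_le0.
  apply: le_trans (infconv_le _ [tuple] f0) _.
  rewrite /sqdist big_nil mul0r addr0.
  by rewrite (tuple0 (tuple_real _)).
pose fb (b : bool) (y : N.-tuple R) := f [tuple of b%:R :: y].
have fb0 b y : 0 <= fb b y by apply: f0.
have cfb b : convex_tuple (fb b).
  move=> t x y t01; have := cf t [tuple of b%:R :: x] [tuple of b%:R :: y] t01.
  apply: le_trans; rewrite /fb le_eqVlt; apply/orP; left; apply/eqP; congr f.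
  by apply: val_inj => /=; congr (_ :: _); ring.
pose E b := tmean p (fun x => expR (- fb b (tuple_real x))).
have E0 b : 0 < E b by apply: tmean_gt0 => // t; apply: expR_gt0.
pose g b := - ln (E b).
have Eg b : E b = expR (- g b) by rewrite opprK lnK// posrE.
have ihb b : tmean p (fun x : N.-tuple bool => expR (infconv (fb b) x)) <= expR (g b).
  have := ih (fb b) (fb0 b) (cfb b); rewrite -/(E b) Eg expRN.
  by rewrite ler_pdivrMr ?expR_gt0// mul1r.
have [[t0 t1] /= /andP[t001 t101]] := two_point (g false) (g true) p01.
apply: le_trans; rewrite 2!tmean_cons -!Eg.
have -> : tmean p (fun t : N.-tuple bool =>
    expR (- f (tuple_real [tuple of false :: t]))) = E false.
  apply: eq_bigr => t _; congr (_ * expR (- f _)).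
  exact: val_inj.
have -> : tmean p (fun t : N.-tuple bool =>
    expR (- f (tuple_real [tuple of true :: t]))) = E true.
  apply: eq_bigr => t _; congr (_ * expR (- f _)).
  exact: val_inj.
apply: ler_wpM2r.
  by rewrite addr_ge0// mulr_ge0 ?(ltW (E0 _))//; lra.
have step b c t : 0 <= t <= 1 ->
    tmean p (fun x : N.-tuple bool => expR (infconv f (b :: x))) <=
    expR ((1 - t) * g b + t * g c + t ^+ 2 / 9).
  move=> t01; rewrite expRD mulrC.
  apply: (@le_trans _ _ (tmean p (fun x : N.-tuple bool => expR (t ^+ 2 / 9) *
      expR ((1 - t) * infconv (fb b) x + t * infconv (fb c) x)))).
    apply: le_tmean => // x; rewrite -expRD ler_expR addrC.
    exact: infconv_cons.
  rewrite tmeanZ ler_wpM2l ?expR_ge0//.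
  exact: tmean_expR_hoelder.
by rewrite lerD// ler_wpM2l//; [lra|exact: step|lra|exact: step].
Qed.

End bernoulli_tuples.

(** * Bernoulli configurations *)

Lemma tnth_zip_tuple (T1 T2 : Type) N (x : N.-tuple T1) (y : N.-tuple T2) i :
  tnth (zip_tuple x y) i = (tnth x i, tnth y i).
Proof.
rewrite (tnth_nth (tnth x i, tnth y i)) /= nth_zip ?size_tuple//.
by rewrite -!tnth_nth.
Qed.

Section bernoulli_configurations.
Variables (R : realType) (I : finType).
Implicit Types (p c : R) (F G : {ffun I -> bool} -> R).

Definition bmean p F : R := \sum_(a : {ffun I -> bool}) (\prod_i bern p (a i)) * F a.

Lemma eq_bmean p F G : F =1 G -> bmean p F = bmean p G.
Proof. by move=> FG; apply: eq_bigr => a _; rewrite FG. Qed.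

Lemma bmeanE p F :
  bmean p F = tmean p (fun t : #|I|.-tuple bool => F [ffun i => tnth t (enum_rank i)]).
Proof.
rewrite /bmean (reindex (fun t : #|I|.-tuple bool => [ffun i => tnth t (enum_rank i)])).
  apply: eq_bigr => t _; congr (_ * _); rewrite big_tuple.
  rewrite (reindex (@enum_rank I)); last by apply: onW_bij; exact: enum_rank_bij.
  by apply: eq_bigr => i _; rewrite ffunE.
exists (fun a : {ffun I -> bool} => [tuple a (enum_val k) | k < #|I|]) => [t _|a _].
  by apply: eq_from_tnth => k; rewrite tnth_mktuple ffunE enum_valK.
by apply/ffunP => i; rewrite ffunE tnth_mktuple enum_rankK.
Qed.

Lemma le_bmean p F G : 0 <= p <= 1 -> (forall a, F a <= G a) -> bmean p F <= bmean p G.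
Proof. by move=> p01 FG; rewrite !bmeanE le_tmean. Qed.

Lemma bmeanZ p c F : bmean p (fun a => c * F a) = c * bmean p F.
Proof. by rewrite !bmeanE tmeanZ. Qed.

Lemma bmeanD p F G : bmean p (fun a => F a + G a) = bmean p F + bmean p G.
Proof. by rewrite !bmeanE tmeanD. Qed.

Lemma bmean_cst p c : bmean p (fun=> c) = c.
Proof. by rewrite bmeanE tmean_cst. Qed.

Lemma bmean_ge0 p F : 0 <= p <= 1 -> (forall a, 0 <= F a) -> 0 <= bmean p F.
Proof. by move=> p01 F0; rewrite -(bmean_cst p 0) le_bmean. Qed.

Lemma bmean_sum p (J : Type) (r : seq J) (P : pred J) (F : J -> {ffun I -> bool} -> R) :
  bmean p (fun a => \sum_(j <- r | P j) F j a) = \sum_(j <- r | P j) bmean p (F j).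
Proof.
by rewrite exchange_big; apply: eq_bigr => a _; rewrite mulr_sumr.
Qed.

Lemma expR_bmean p F : 0 <= p <= 1 ->
  expR (bmean p F) <= bmean p (fun a => expR (F a)).
Proof.
move=> p01; set m := bmean p F.
have -> : expR m = bmean p (fun a => expR m * (1 - m) + expR m * F a).
  by rewrite bmeanD bmean_cst bmeanZ -[bmean p (fun=> _)]/m; ring.
apply: le_bmean => // a.
rewrite (_ : expR (F a) = expR m * expR (F a - m)); last by rewrite -expRD subrKC.
rewrite -mulrDr ler_wpM2l ?expR_ge0//.
by apply: le_trans (expR_ge1Dx _); lra.
Qed.

Definition convex_ffun (f : (I -> R) -> R) :=
  forall t x y, 0 <= t <= 1 ->
    f (fun i => (1 - t) * x i + t * y i) <= (1 - t) * f x + t * f y.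

Definition real_config (a : {ffun I -> bool}) (i : I) : R := (a i)%:R.

(* The last hypothesis says that the infimum convolution of [f] is at least
   [f - c]; both tails then follow from [maurey] by Jensen's inequality. *)
Lemma convex_concentration p (f : (I -> R) -> R) (c : R) : 0 <= p <= 1 ->
    (forall y, 0 <= f y) -> convex_ffun f ->
    (forall a y, f (real_config a) - f y <= (\sum_i (real_config a i - y i) ^+ 2) / 9 + c) ->
  let m := bmean p (fun a => f (real_config a)) in
  bmean p (fun a => expR (f (real_config a) - m)) <= expR c /\
  bmean p (fun a => expR (m - f (real_config a))) <= expR c.
Proof.
move=> p01 f0 cf hf m.
pose u (T : Type) (t : #|I|.-tuple T) (i : I) := tnth t (enum_rank i).
pose g (y : #|I|.-tuple R) := f (u _ y).
have uE (t : #|I|.-tuple bool) : u _ (tuple_real R t) =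
    real_config [ffun i => tnth t (enum_rank i)].
  by apply/funext => i; rewrite /u /real_config tnth_map ffunE.
have cg : convex_tuple g.
  move=> t x y t01; apply: le_trans (cf _ _ _ t01).
  rewrite /g le_eqVlt; apply/orP; left; apply/eqP; congr f; apply/funext => i.
  by rewrite /u /mix tnth_map tnth_zip_tuple.
have := maurey p01 (fun y => f0 (u _ y)) cg.
have -> : tmean p (fun x : #|I|.-tuple bool => expR (- g (tuple_real R x))) =
          bmean p (fun a => expR (- f (real_config a))).
  by rewrite bmeanE; apply: eq_bigr => t _; rewrite /g uE.
set E1 := bmean _ _.
have h1 : expR (- c) * bmean p (fun a => expR (f (real_config a))) <=
    tmean p (fun x : #|I|.-tuple bool => expR (infconv g x)).
  rewrite bmeanE -tmeanZ; apply: le_tmean => // t.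
  rewrite -expRD ler_expR addrC.
  rewrite -[X in _ <= X]mul1r -[X in _ <= X]addr0; apply: le_infconv => // y.
  have := hf [ffun i => tnth t (enum_rank i)] (u _ y).
  rewrite -uE mul1r addr0 /g.
  have -> : \sum_i (u _ (tuple_real R t) i - u _ y i) ^+ 2 = sqdist t y.
    rewrite /sqdist [RHS](big_tuple _ _ (zip_tuple t y)).
    rewrite [RHS](reindex (@enum_rank I)); last by apply: onW_bij; exact: enum_rank_bij.
    by apply: eq_bigr => i _; rewrite tnth_zip_tuple /u tnth_map.
  lra.
move=> h2.
have E10 : 0 <= E1 by apply: bmean_ge0 => // a; apply: expR_ge0.
have h3 : expR (- c) * bmean p (fun a => expR (f (real_config a))) * E1 <= 1.
  by apply: le_trans h2; rewrite ler_wpM2r.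
have j1 : expR (- m) <= E1.
  have <- : bmean p (fun a => - f (real_config a)) = - m.
    by rewrite -[RHS]mulN1r -bmeanZ; apply: eq_bmean => a; rewrite mulN1r.
  exact: expR_bmean.
have j2 : expR m <= bmean p (fun a => expR (f (real_config a))) by exact: expR_bmean.
have red x : expR (- c) * x <= 1 -> x <= expR c.
  by rewrite expRN mulrC ler_pdivrMr ?expR_gt0// mul1r.
split; apply: red.
  apply: le_trans h3; rewrite -mulrA; apply: ler_wpM2l; first exact: expR_ge0.
  have -> : bmean p (fun a => expR (f (real_config a) - m)) =
    expR (- m) * bmean p (fun a => expR (f (real_config a))).
    by rewrite -bmeanZ; apply: eq_bmean => a; rewrite -expRD addrC.
  rewrite mulrC; apply: ler_wpM2l => //.
  by apply: bmean_ge0 => // a; apply: expR_ge0.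
apply: le_trans h3; rewrite -mulrA; apply: ler_wpM2l; first exact: expR_ge0.
have -> : bmean p (fun a => expR (m - f (real_config a))) = expR m * E1.
  by rewrite -bmeanZ; apply: eq_bmean => a; rewrite -expRD.
exact: ler_wpM2r.
Qed.

Lemma bmean_prod p (phi : I -> bool -> R) :
  bmean p (fun a => \prod_i phi i (a i)) =
  \prod_i ((1 - p) * phi i false + p * phi i true).
Proof.
rewrite /bmean (eq_bigr (fun a : {ffun I -> bool} =>
    \prod_i (bern p (a i) * phi i (a i)))); last first.
  by move=> a _; rewrite big_split.
rewrite -(bigA_distr_bigA (fun i b => bern p b * phi i b)).
by apply: eq_bigr => i _; rewrite big_bool /= addrC.
Qed.

Definition cent p (a : {ffun I -> bool}) (i : I) : R := (a i)%:R - p.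

Definition no_singleton (es : seq I) := all (fun e => (1 < count_mem e es)%N) es.

(** The mean factorizes over distinct indices. An index occurring once contributes the mean 0; one
    occurring at least twice contributes at most the variance p(1-p), as centered variables are
    bounded by 1. *)
Lemma bmean_prod_cent_le p (es : seq I) : 0 <= p <= 1 ->
  `|bmean p (fun a => \prod_(e <- es) cent p a e)| <=
  (no_singleton es)%:R * p ^+ size (undup es).
Proof.
move=> p01.
have -> : bmean p (fun a => \prod_(e <- es) cent p a e) =
    \prod_i ((1 - p) * (- p) ^+ count_mem i es + p * (1 - p) ^+ count_mem i es).
  pose phi i (b : bool) : R := (b%:R - p) ^+ count_mem i es.
  rewrite (eq_bigr (fun i => (1 - p) * phi i false + p * phi i true)); last first.
    by move=> i _; rewrite /phi sub0r.
  rewrite -bmean_prod; apply: eq_bmean => a; rewrite /phi /cent {phi}.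
  elim: es => [|e es ih]; first by rewrite big_nil big1// => i _; rewrite expr0.
  rewrite big_cons ih (bigD1 e)//= [RHS](bigD1 e)//= eqxx add1n exprS mulrA.
  by congr (_ * _); apply: eq_bigr => i /negPf ie; rewrite eq_sym ie add0n.
rewrite normr_prod.
have [/allP ns|] := boolP (no_singleton es); last first.
  move=> /allPn[e ee]; rewrite -leqNgt => ce; rewrite mul0r (bigD1 e)//=.
  have -> : count_mem e es = 1%N.
    by apply/eqP; rewrite eqn_leq ce -has_count has_pred1.
  by rewrite !expr1 (_ : _ + _ = 0) ?normr0 ?mul0r//; ring.
rewrite mul1r (bigID (mem es)) /= [X in _ * X]big1 ?mulr1; last first.
  by move=> i /count_memPn ->; rewrite !expr0 !mulr1 subrK normr1.
have -> : size (undup es) = #|mem es|.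
  rewrite -(card_uniqP (undup_uniq es)); apply: eq_card => i.
  by rewrite mem_undup.
rewrite -prodr_const; apply: ler_prod => i ie; rewrite normr_ge0 /=.
have := ns i ie; set k := count_mem i es => k2.
have -> : k = (k.-2).+2 by lia.
set j := k.-2.
apply: le_trans (ler_normD _ _) _.
rewrite [`|(1 - p) * _|]normrM [`|p * _|]normrM.
rewrite [`|(- p) ^+ _|]normrX [`|(1 - p) ^+ _|]normrX normrN.
rewrite [`|p|]ger0_norm ?[`|1 - p|]ger0_norm//; try lra.
have h1 : p ^+ j <= 1 by rewrite exprn_ile1//; lra.
have h2 : (1 - p) ^+ j <= 1 by rewrite exprn_ile1//; lra.
have h3 : (1 - p) * p ^+ j.+2 <= (1 - p) * p ^+ 2.
  rewrite ler_wpM2l//; first by lra.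
  by rewrite -addn2 exprD -[leRHS]mul1r ler_wpM2r ?sqr_ge0.
have h4 : p * (1 - p) ^+ j.+2 <= p * (1 - p) ^+ 2.
  rewrite ler_wpM2l//; first by lra.
  rewrite -addn2 exprD -[leRHS]mul1r ler_wpM2r ?sqr_ge0//.
nra.
Qed.

(** The moments are carried jointly through the induction. The third one is absent because, in the
    expansion of the fourth power, its coefficient is four times the mean of the new centered
    variable, that is, 0. *)
Lemma tmean_centered_sum (p : R) (N : nat) : 0 <= p <= 1 ->
  let S (t : N.-tuple bool) := \sum_(b <- t) ((b : bool)%:R - p) in
  [/\ tmean p S = 0, tmean p (fun t => S t ^+ 2) = N%:R * (p * (1 - p)) &
      tmean p (fun t => S t ^+ 4) <= N%:R * p + 3 * (N%:R * p) ^+ 2].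
Proof.
move=> p01; elim: N => [|N [ih1 ih2 ih4]] /=.
  rewrite !tmean_nil !big_nil /=; split; rewrite ?expr0n ?mul0r//.
  by rewrite expr0n mulr0 addr0.
pose S (t : N.-tuple bool) : R := \sum_(b <- t) ((b : bool)%:R - p).
pose m k := tmean p (fun t => S t ^+ k).
have m1 : m 1%N = 0 by rewrite -[RHS]ih1; apply: eq_bigr => t _; rewrite expr1.
have m2 : m 2%N = N%:R * (p * (1 - p)) by [].
have poly k (c0 c1 c2 c3 c4 d : R) :
    (forall x, (d + x) ^+ k = c0 + c1 * x + c2 * x ^+ 2 + c3 * x ^+ 3 + c4 * x ^+ 4) ->
    tmean p (fun t => (d + S t) ^+ k) =
    c0 + c1 * m 1%N + c2 * m 2%N + c3 * m 3%N + c4 * m 4%N.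
  move=> h; rewrite /m -!tmeanZ -[c0 in RHS](tmean_cst p N) -!tmeanD.
  by apply: eq_bigr => t _; rewrite h expr1.
have cons_expand k : tmean p (fun t : N.+1.-tuple bool =>
     (\sum_(b <- t) ((b : bool)%:R - p)) ^+ k) =
   (1 - p) * tmean p (fun t => (- p + S t) ^+ k) +
   p * tmean p (fun t => (1 - p + S t) ^+ k).
  rewrite tmean_cons; congr (_ * _ + _ * _); apply: eq_bigr => t _;
    by rewrite big_cons /= ?sub0r.
split.
- rewrite (_ : tmean p _ = tmean p (fun t : N.+1.-tuple bool =>
     (\sum_(b <- t) ((b : bool)%:R - p)) ^+ 1)); last first.
    by apply: eq_bigr => t _; rewrite expr1.
  rewrite cons_expand (poly 1%N (- p) 1 0 0 0); last by move=> x; ring.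
  rewrite (poly 1%N (1 - p) 1 0 0 0); last by move=> x; ring.
  by rewrite m1; ring.
- rewrite cons_expand (poly 2%N (p ^+ 2) (- 2 * p) 1 0 0); last by move=> x; ring.
  rewrite (poly 2%N ((1 - p) ^+ 2) (2 * (1 - p)) 1 0 0); last by move=> x; ring.
  by rewrite m1 m2 -[N.+1%:R]natr1; ring.
rewrite cons_expand.
rewrite (poly 4%N (p ^+ 4) (- 4 * p ^+ 3) (6 * p ^+ 2) (- 4 * p) 1); last by move=> x; ring.
rewrite (poly 4%N ((1 - p) ^+ 4) (4 * (1 - p) ^+ 3) (6 * (1 - p) ^+ 2)
  (4 * (1 - p)) 1); last by move=> x; ring.
rewrite m1 m2 -[N.+1%:R]natr1.
have m4 : m 4%N <= N%:R * p + 3 * (N%:R * p) ^+ 2 by [].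
have N0 : 0 <= N%:R :> R by [].
move: (N%:R) N0 m4 => n n0 m4.
set L := (X in X <= _).
have -> : L = m 4%N + 6 * n * (p * (1 - p)) ^+ 2 + p * (1 - p) * (1 - 3 * p * (1 - p)).
  by rewrite /L; ring.
have h1 : (p * (1 - p)) ^+ 2 <= p ^+ 2.
  by rewrite ler_sqr ?nnegrE; nra.
have h2 : p * (1 - p) * (1 - 3 * p * (1 - p)) <= p.
  have : 0 <= p * (1 - p) <= p by nra.
  have -> : 1 - 3 * p * (1 - p) = 1 - 3 * (p * (1 - p)) by ring.
  by set x := p * (1 - p); nra.
have := ler_wpM2l n0 h1; have := sqr_ge0 p. lra.
Qed.

Lemma bmean_centered_sum_pow4 p : 0 <= p <= 1 ->
  bmean p (fun a => (\sum_i cent p a i) ^+ 4) <=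
  #|I|%:R * p + 3 * (#|I|%:R * p) ^+ 2.
Proof.
move=> p01; rewrite bmeanE; have [_ _] := tmean_centered_sum #|I| p01.
apply: le_trans; rewrite le_eqVlt; apply/orP; left; apply/eqP.
apply: eq_bigr => t _; congr (_ * _ ^+ 4); rewrite big_tuple.
rewrite [RHS](reindex (@enum_rank I)); last by apply: onW_bij; exact: enum_rank_bij.
by apply: eq_bigr => i _; rewrite /cent ffunE.
Qed.

End bernoulli_configurations.

(** * Weighted graphs *)

Section graph_matrices.
Variables (R : realType) (n : nat).

Definition pair_of := {e : 'I_n * 'I_n | e \in upper_pairs n}.

(** The value is [None] exactly on the diagonal, where [gmx] therefore has zero entries. *)
Definition edge (i j : 'I_n) : option pair_of :=
  insub (if (i < j)%N then (i, j) else (j, i)).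

Lemma edge_sym i j : edge i j = edge j i.
Proof. by rewrite /edge; case: ltngtP => // /val_inj ->. Qed.

Lemma edge_lt (i j : 'I_n) (ij : (i, j) \in upper_pairs n) :
  edge i j = Some (exist _ (i, j) ij).
Proof.
have := ij; rewrite inE /= /edge => -> .
by rewrite insubT.
Qed.

Lemma edge_diag i : edge i i = None.
Proof. by rewrite /edge ltnn insubF// inE /= ltnn. Qed.

Lemma edgeP i j e : edge i j = Some e -> val e = (i, j) \/ val e = (j, i).
Proof.
rewrite /edge; case: insubP => // u _ uE [<-].
by rewrite uE; case: ifP; [left | right].
Qed.

Lemma edge_eq i j k l e : edge i j = Some e -> edge k l = Some e ->
  (i = k /\ j = l) \/ (i = l /\ j = k).
Proof.
move=> /edgeP h1 /edgeP; case: h1 => -> [[-> ->]|[-> ->]];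
  by [left|right|right|left].
Qed.

Definition gmx (x : pair_of -> R) : 'M[R]_n := \matrix_(i, j) oapp x 0 (edge i j).

Lemma gmx_sym x : (gmx x)^T = gmx x.
Proof. by apply/matrixP => i j; rewrite !mxE edge_sym. Qed.

Lemma sum_edges (x : pair_of -> R) (g : 'I_n -> 'I_n -> R) :
    (forall i j, g i j = g j i) ->
  \sum_i \sum_j oapp x 0 (edge i j) * g i j =
  2 * \sum_e x e * g (val e).1 (val e).2.
Proof.
move=> gC; rewrite pair_big /=.
pose F (q : 'I_n * 'I_n) := oapp x 0 (edge q.1 q.2) * g q.1 q.2.
rewrite -/(F _) (eq_bigr F)// (bigID (mem (upper_pairs n))) /=.
have upE : \sum_(q in upper_pairs n) F q = \sum_e x e * g (val e).1 (val e).2.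
  rewrite big_sub; apply: eq_bigr => -[[i j] ij] _.
  by rewrite /F /= (edge_lt ij).
rewrite upE mulr2n mulrDl !mul1r; congr (_ + _); rewrite -upE.
rewrite (bigID (fun q : 'I_n * 'I_n => (q.2 < q.1)%N)) /= [X in _ + X]big1 ?addr0; last first.
  move=> [i j]; rewrite inE /= -!leqNgt => /andP[ji ij].
  have -> : i = j by apply: val_inj; apply/eqP; rewrite eqn_leq ij ji.
  by rewrite /F /= edge_diag mul0r.
rewrite (reindex (fun q : 'I_n * 'I_n => (q.2, q.1)))/=; last first.
  by exists (fun q : 'I_n * 'I_n => (q.2, q.1)) => -[].
apply: eq_big => [[i j]|[i j] _] /=; last by rewrite /F /= edge_sym gC.
by rewrite !inE /= -leqNgt; case: ltngtP.
Qed.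

Lemma dotv_gmx x (v : 'rV[R]_n) :
  dotv (v *m gmx x) v = 2 * \sum_e x e * (v 0 (val e).1 * v 0 (val e).2).
Proof.
rewrite -(@sum_edges x (fun i j => v 0 i * v 0 j)); last by move=> i j; rewrite mulrC.
rewrite exchange_big; apply: eq_bigr => j _.
rewrite mxE mulr_suml; apply: eq_bigr => i _.
by rewrite mxE mulrCA mulrA.
Qed.

Lemma sum_edges_le (g : 'I_n -> 'I_n -> R) :
    (forall i j, g i j = g j i) -> (forall i j, 0 <= g i j) ->
  2 * \sum_(e : pair_of) g (val e).1 (val e).2 <= \sum_i \sum_j g i j.
Proof.
move=> gC g0; rewrite (eq_bigr (fun e : pair_of => 1 * g (val e).1 (val e).2)); last first.
  by move=> e _; rewrite mul1r.
rewrite -(@sum_edges (fun=> 1))//.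
apply: ler_sum => i _; apply: ler_sum => j _.
by rewrite ler_piMl//; case: (edge i j).
Qed.

Lemma card_pair_of_le : (#|{: pair_of}| * 2 <= n ^ 2)%N.
Proof.
have := @sum_edges_le (fun _ _ => 1) (fun _ _ => erefl) (fun _ _ => ler01).
rewrite !sumr_const card_ord -natrM -mulrnA.
by rewrite ler_nat mulnC -mulnn.
Qed.

End graph_matrices.

Section graph_eigenvalues.
Variables (R : realType) (n : nat).
Local Notation I := (pair_of n.+1).
Implicit Types (x y : I -> R) (v : 'rV[R]_n.+1).

Definition glam x : R := largest_eigenvalue (gmx x).

Lemma glam_ge x v : dotv (v *m gmx x) v <= glam x * dotv v v.
Proof. exact: rayleigh_le (gmx_sym x). Qed.

Lemma glam_attained x : exists2 v, dotv v v = 1 & dotv (v *m gmx x) v = glam x.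
Proof. exact: rayleigh_max (gmx_sym x). Qed.

Lemma glam_ge0 x : 0 <= glam x.
Proof.
pose v : 'rV[R]_n.+1 := delta_mx 0 0.
have v1 : dotv v v = 1.
  rewrite /dotv (bigD1 0)//= !mxE eqxx mulr1 big1 ?addr0// => i /negPf i0.
  by rewrite !mxE i0 andbF mul0r.
have := glam_ge x v; rewrite v1 mulr1; apply: le_trans.
rewrite dotv_gmx mulr_ge0// sumr_ge0// => e _.
have := valP e; rewrite inE !mxE /=.
have [->|_] := eqVneq (val e).2 0; first by rewrite ltn0.
by rewrite !mulr0.
Qed.

Lemma glam_convex : convex_ffun glam.
Proof.
move=> t x y t01; have [v v1 <-] := glam_attained (fun i => (1 - t) * x i + t * y i).
have -> : dotv (v *m gmx (fun i => (1 - t) * x i + t * y i)) v =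
   (1 - t) * dotv (v *m gmx x) v + t * dotv (v *m gmx y) v.
  rewrite !dotv_gmx !mulr_sumr -big_split; apply: eq_bigr => e _ /=; ring.
have := glam_ge x v; have := glam_ge y v; rewrite v1 !mulr1 => h1 h2.
nra.
Qed.

(** Test [y] with a top eigenvector [v] of [x] and apply AM-GM on each edge: 2 s (x e - y e) w <= (x
    e - y e)^2 / 9 + 9 s^2 w^2 with w the product of the two entries of [v]. The squares of these w
    sum to at most 1. This is the cost that [convex_concentration] expects. *)
Lemma glam_lipschitz (s : R) x y : 0 <= s ->
  s * (glam x - glam y) <= (\sum_e (x e - y e) ^+ 2) / 9 + 9 * s ^+ 2.
Proof.
move=> s0; have [v v1 vx] := glam_attained x.
have := glam_ge y v; rewrite v1 mulr1 => vy.
apply: (@le_trans _ _ (s * (dotv (v *m gmx x) v - dotv (v *m gmx y) v))).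
  by apply: ler_wpM2l => //; lra.
pose g (i j : 'I_n.+1) : R := v 0 i ^+ 2 * v 0 j ^+ 2.
have hg : 2 * \sum_(e : I) g (val e).1 (val e).2 <= 1.
  apply: le_trans (sum_edges_le _ _) _ => [i j|i j|].
  - by rewrite /g mulrC.
  - by rewrite /g mulr_ge0 ?sqr_ge0.
  have -> : \sum_i \sum_j g i j = dotv v v * dotv v v.
    rewrite /dotv mulr_suml; apply: eq_bigr => i _.
    by rewrite mulr_sumr; apply: eq_bigr => j _; rewrite /g !expr2.
  by rewrite v1 mulr1.
have h : s * (dotv (v *m gmx x) v - dotv (v *m gmx y) v) <=
    (\sum_e (x e - y e) ^+ 2) / 9 + 9 * s ^+ 2 * \sum_(e : I) g (val e).1 (val e).2.
  rewrite !dotv_gmx -mulrBr -sumrB !mulr_sumr mulr_suml -big_split /=.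
  apply: ler_sum => e _.
  have -> : g (val e).1 (val e).2 = (v 0 (val e).1 * v 0 (val e).2) ^+ 2.
    by rewrite exprMn.
  set w := v 0 (val e).1 * v 0 (val e).2.
  have := sqr_ge0 ((x e - y e) / 3 - 3 * s * w); lra.
apply: le_trans h _; rewrite lerD2l ler_piMr ?mulr_ge0 ?sqr_ge0//.
apply: le_trans hg; rewrite mulr2n mulrDl mul1r lerDl.
by apply: sumr_ge0 => e _; rewrite mulr_ge0 ?sqr_ge0.
Qed.

(** Taking absolute values in a top eigenvector keeps its norm and, the weights being nonnegative,
    does not decrease the quadratic form. *)
Lemma glam_mono x y : (forall e, 0 <= x e <= y e) -> glam x <= glam y.
Proof.
move=> xy; have [v v1 <-] := glam_attained x.
pose w : 'rV[R]_n.+1 := \row_i `|v 0 i|.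
have w1 : dotv w w = 1.
  rewrite -v1; apply: eq_bigr => i _.
  by rewrite !mxE -expr2 real_normK ?num_real// expr2.
have := glam_ge y w; rewrite w1 mulr1; apply: le_trans.
rewrite !dotv_gmx ler_wpM2l//; apply: ler_sum => e _.
rewrite !mxE -normrM; have /andP[x0 xle] := xy e.
apply: le_trans (ler_wpM2l x0 (ler_norm _)) _.
by rewrite ler_wpM2r.
Qed.

Lemma glam_le_order x : (forall e, 0 <= x e <= 1) -> glam x <= n.+1%:R.
Proof.
move=> x01; have [v v1 <-] := glam_attained x.
rewrite dotv_gmx.
pose g (i j : 'I_n.+1) : R := (v 0 i ^+ 2 + v 0 j ^+ 2) / 2.
apply: (@le_trans _ _ (2 * \sum_(e : I) g (val e).1 (val e).2)).
  rewrite ler_wpM2l//; apply: ler_sum => e _; rewrite /g.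
  set a := v 0 _; set b := v 0 _; have := x01 e; set z := x e => hz.
  have := sqr_ge0 (a - b); have := sqr_ge0 (a + b).
  have [ab|ab] := leP 0 (a * b); nra.
apply: le_trans (sum_edges_le _ _) _ => [i j|i j|].
- by rewrite /g addrC.
- by rewrite /g divr_ge0// addr_ge0// sqr_ge0.
have -> : \sum_i \sum_j g i j = \sum_(i < n.+1) (n.+1%:R * v 0 i ^+ 2 + 1) / 2.
  apply: eq_bigr => i _; rewrite -mulr_suml big_split /= sumr_const card_ord.
  congr ((_ + _) / 2); first by rewrite mulr_natl.
  by rewrite -v1; apply: eq_bigr => j _; rewrite expr2.
rewrite -mulr_suml big_split /= -mulr_sumr sumr_const card_ord.
rewrite (_ : \sum_i _ = dotv v v); last by apply: eq_bigr => j _; rewrite expr2.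
by rewrite v1 mulr1 -mulr2n -[X in X / 2]mulr_natr mulfK.
Qed.

Lemma glam_concentration (p s : R) : 0 <= p <= 1 -> 0 <= s ->
  let m := bmean p (fun a => glam (real_config R a)) in
  bmean p (fun a => expR (s * (glam (real_config R a) - m))) <= expR (9 * s ^+ 2) /\
  bmean p (fun a => expR (s * (m - glam (real_config R a)))) <= expR (9 * s ^+ 2).
Proof.
move=> p01 s0 m.
have [|||h1 h2] := @convex_concentration R _ p (fun x => s * glam x) (9 * s ^+ 2) p01.
- by move=> y; rewrite mulr_ge0 ?glam_ge0.
- move=> t x y t01; have := ler_wpM2l s0 (glam_convex x y t01); lra.
- move=> a y; rewrite -mulrBr; exact: glam_lipschitz.
rewrite bmeanZ -/m in h1 h2.
split; [apply: le_trans h1|apply: le_trans h2]; rewrite le_eqVlt; apply/orP; left;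
  by apply/eqP; apply: eq_bmean => a; rewrite mulrBr.
Qed.

End graph_eigenvalues.

(** * The centered adjacency matrix *)

Section centered_adjacency.
Variables (R : realType) (n : nat).
Local Notation I := (pair_of n.+1).
Local Notation N := (n.+1%:R : R).
Implicit Types (x xi : I -> R) (v : 'rV[R]_n.+1) (a : {ffun I -> bool}) (p : R).

Let one : 'rV[R]_n.+1 := const_mx 1.

Lemma edge_neq m (i j : 'I_m) : i != j -> exists e, edge i j = Some e.
Proof.
rewrite neq_ltn => /orP[] ij.
  have ij' : (i, j) \in upper_pairs m by rewrite inE.
  by rewrite (edge_lt ij'); eexists.
have ij' : (j, i) \in upper_pairs m by rewrite inE.
by rewrite edge_sym (edge_lt ij'); eexists.
Qed.

Lemma dotv_one v : dotv v one = \sum_i v 0 i.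
Proof. by apply: eq_bigr => i _; rewrite mxE mulr1. Qed.

Lemma dotv_one_one : dotv one one = N.
Proof.
by rewrite dotv_one; under eq_bigr do rewrite mxE; rewrite sumr_const card_ord.
Qed.

Lemma dotv_gmx_shift p xi v :
  dotv (v *m gmx (fun e => p + xi e)) v =
  p * (dotv v one ^+ 2 - dotv v v) + dotv (v *m gmx xi) v.
Proof.
rewrite !dotv_gmx.
have <- : 2 * \sum_(e : I) (fun=> 1) e * (v 0 (val e).1 * v 0 (val e).2) =
    dotv v one ^+ 2 - dotv v v.
  rewrite -(@sum_edges _ _ (fun=> 1) (fun i j => v 0 i * v 0 j)); last first.
    by move=> i j; rewrite mulrC.
  rewrite dotv_one expr2 mulr_suml /dotv -sumrB; apply: eq_bigr => i _.
  rewrite mulr_sumr (bigD1 i)//= [in RHS](bigD1 i)//= edge_diag mul0r add0r.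
  rewrite addrC addrK; apply: eq_bigr => j ij.
  by rewrite eq_sym in ij; have [e ->] := edge_neq ij; rewrite mul1r.
rewrite !mulr_sumr -big_split; apply: eq_bigr => e _ /=; ring.
Qed.

(* Split a top eigenvector along the all-ones vector: the cross term is absorbed
   by AM-GM thanks to the gap between [N p] and the norm of [gmx xi]. *)
Lemma glam_upper p xi : 0 < p ->
    (forall z, `|dotv (z *m gmx xi) z| <= N * p / 4 * dotv z z) ->
  glam (fun e => p + xi e) <=
  N * p + 2 * `|\sum_e xi e| / N +
  2 * dotv (one *m gmx xi) (one *m gmx xi) / (N ^+ 2 * p).
Proof.
move=> p0 hW; have [v v1 <-] := glam_attained (fun e => p + xi e).
rewrite dotv_gmx_shift v1; set W := gmx xi in hW *.
set S := \sum_e xi e; set Y := dotv _ (one *m W).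
have N0 : 0 < N by [].
pose t := dotv v one / N; pose z := v - t *: one.
have tN : dotv v one = t * N by rewrite /t divfK ?gt_eqF.
have vE : v = t *: one + z by rewrite /z addrC subrK.
have zz : dotv z z = 1 - t ^+ 2 * N.
  rewrite /z -scaleNr !(dotvDl, dotvDr, dotvZl, dotvZr).
  by rewrite v1 dotv_one_one (dotvC one v) tN; ring.
clearbody z.
have W11 : dotv (one *m W) one = 2 * S.
  rewrite dotv_gmx; congr (_ * _); apply: eq_bigr => e _.
  by rewrite !mxE !mulr1.
have -> : dotv (v *m W) v =
    t ^+ 2 * (2 * S) + 2 * t * dotv (one *m W) z + dotv (z *m W) z.
  rewrite {1 2}vE mulmxDl -scalemxAl !(dotvDl, dotvDr, dotvZl, dotvZr) W11.
  by rewrite (dotv_sym z one (gmx_sym _)) -/W; ring.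
have := dotv_cauchy_schwarz (one *m W) z; rewrite -/Y.
have := hW z; have := dotv_ge0 z; have := dotv_ge0 (one *m W); rewrite -/Y zz.
set c := dotv (one *m W) z; set d := dotv (z *m W) z; set s := 1 - t ^+ 2 * N.
move=> Y0 s0 /(le_trans (ler_norm _)) hd hc; rewrite tN.
have t2 : t ^+ 2 <= N^-1.
  by rewrite -[leRHS]div1r ler_pdivlMr//; rewrite /s in s0; lra.
have t20 := sqr_ge0 t.
have h1 : t ^+ 2 * (2 * S) <= 2 * `|S| / N.
  have := ler_norm S => hS; have S0 := normr_ge0 S.
  rewrite [leRHS]mulrC; apply: (@le_trans _ _ (t ^+ 2 * (2 * `|S|))).
    by apply: ler_wpM2l => //; lra.
  by apply: ler_wpM2r => //; lra.
pose X := s * (N * p) / 2; pose Z := 2 * t ^+ 2 * Y / (N * p).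
have Np : 0 < N * p by rewrite mulr_gt0.
have X0 : 0 <= X by apply: divr_ge0 => //; apply: mulr_ge0 => //; apply: ltW.
have Z0 : 0 <= Z by apply: divr_ge0 (ltW Np); apply: mulr_ge0 => //; apply: mulr_ge0.
have h2 : 2 * t * c <= X + Z.
  have XZ : X * Z = t ^+ 2 * (Y * s).
    by rewrite /X /Z; field; rewrite !gt_eqF.
  have : (2 * t * c) ^+ 2 <= (X + Z) ^+ 2.
    have := ler_wpM2l t20 hc; have := sqr_ge0 (X - Z); rewrite -XZ. lra.
  rewrite -[X in X <= _]real_normK ?num_real// ler_sqr ?nnegrE ?addr_ge0//.
  exact: le_trans (ler_norm _).
have h3 : Z <= 2 * Y / (N ^+ 2 * p).
  have -> : 2 * Y / (N ^+ 2 * p) = 2 * Y * N^-1 / (N * p).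
    by field; rewrite !gt_eqF.
  rewrite /Z ler_wpM2r ?invr_ge0 ?(ltW Np)//.
  by rewrite mulrAC ler_wpM2l// mulr_ge0.
have h4 : p * ((t * N) ^+ 2 - 1) = p * N * (1 - s) - p by rewrite /s; ring.
rewrite h4; move: h2 h3; rewrite /X => h2 h3.
have : 0 <= s * (N * p) by rewrite mulr_ge0// ltW.
move: h1 h2 h3 hd p0; move: (2 * `|S| / N) (2 * Y / _) => a b.
clear; move: (t ^+ 2 * _) (2 * t * c) Z d s N => x1 x2 x3 x4 x5 x6.
lra.
Qed.

(** The triple [(i, j, k)] is the path of length two with center [i] and distinct ordered ends [j],
    [k]. These are the off-diagonal terms in the squared norm of the vector of row sums. *)
Definition cherries xi : R :=
  \sum_(q : 'I_n.+1 * 'I_n.+1 * 'I_n.+1 | q.1.2 != q.2)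
    gmx xi q.1.1 q.1.2 * gmx xi q.1.1 q.2.

Lemma dotv_one_gmx xi :
  dotv (one *m gmx xi) (one *m gmx xi) = 2 * \sum_e xi e ^+ 2 + cherries xi.
Proof.
pose w i j := gmx xi i j.
have -> : dotv (one *m gmx xi) (one *m gmx xi) = \sum_i \sum_j \sum_k w i j * w i k.
  apply: eq_bigr => i _; rewrite mxE mulr_suml; apply: eq_bigr => j _.
  rewrite mulr_sumr; apply: eq_bigr => k _.
  by rewrite !mxE !mul1r edge_sym [edge k i]edge_sym /w !mxE.
have -> : 2 * \sum_e xi e ^+ 2 = \sum_i \sum_j w i j ^+ 2.
  rewrite -[RHS](_ : \sum_i \sum_j oapp (fun e => xi e ^+ 2) 0 (edge i j) * 1 = _).
    rewrite (@sum_edges _ _ (fun e => xi e ^+ 2) (fun _ _ => 1))//.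
    by congr (_ * _); apply: eq_bigr => e _; rewrite mulr1.
  apply: eq_bigr => i _; apply: eq_bigr => j _.
  by rewrite /w mxE; case: (edge i j) => [e|] /=; rewrite mulr1 ?expr0n.
rewrite /cherries -(pair_big_dep xpredT (fun q k => q.2 != k)
  (fun q k => gmx xi q.1 q.2 * gmx xi q.1 k))/=.
rewrite -(pair_big xpredT xpredT (fun i j => \sum_(k | j != k) gmx xi i j * gmx xi i k))/=.
rewrite -big_split; apply: eq_bigr => i _; rewrite -big_split; apply: eq_bigr => j _ /=.
rewrite (bigD1 j)//= -expr2; congr (_ + _); apply: eq_bigl => k.
by rewrite eq_sym.
Qed.

(** For a 0-1 variable, (a - p)^2 = (1 - 2p)(a - p) + p(1 - p), so the sum of squares is affine in
    the centered edge count. *)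
Lemma sum_sqr_cent_le p a : 0 <= p <= 1 ->
  2 * \sum_e cent p a e ^+ 2 <= 2 * `|\sum_e cent p a e| + N ^+ 2 * p.
Proof.
move=> p01.
have -> : \sum_e cent p a e ^+ 2 =
    (1 - 2 * p) * (\sum_e cent p a e) + #|{: I}|%:R * (p * (1 - p)).
  rewrite mulr_sumr -[X in _ + X](_ : \sum_(e : I) p * (1 - p) = _); last first.
    by rewrite sumr_const mulr_natl.
  rewrite -big_split; apply: eq_bigr => e _; rewrite /cent.
  by case: (a e) => /=; ring.
set S := \sum_e _; set M : R := #|_|%:R.
have hM : 2 * M <= N ^+ 2.
  by rewrite /M -natrX -natrM ler_nat mulnC card_pair_of_le.
have h1 : (1 - 2 * p) * S <= `|S|.
  apply: le_trans (ler_norm _) _; rewrite normrM ler_piMl//.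
  by rewrite ler_norml; lra.
have M0 : 0 <= M by [].
have : M * (p * (1 - p)) <= M * p by rewrite ler_wpM2l//; nra.
have : 2 * M * p <= N ^+ 2 * p by rewrite ler_wpM2r//; lra.
lra.
Qed.

Lemma real_configE p a : real_config R a = (fun e => p + cent p a e).
Proof. by apply/funext => e; rewrite /cent addrC subrK. Qed.

Lemma glam_upper_cent p a : 0 <= p <= 1 -> 1 <= N * p ->
    (forall z, `|dotv (z *m gmx (cent p a)) z| <= N * p / 4 * dotv z z) ->
  glam (real_config R a) <=
  N * p + 3 + 6 * `|\sum_e cent p a e| / N + (cherries (cent p a) / (N ^+ 2 * p)) ^+ 2.
Proof.
move=> p01 Np hW; have N0 : 0 < N by [].
have p0 : 0 < p.
  by rewrite lt_def; apply/andP; split; [apply/eqP => p0; rewrite p0 in Np; lra|lra].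
rewrite (real_configE p); apply: le_trans (glam_upper p0 hW) _.
rewrite dotv_one_gmx; have := sum_sqr_cent_le a p01.
set S := `|_|; set C := cherries _; set Q := \sum_e _ => hQ.
have d0 : 0 < N ^+ 2 * p by rewrite mulr_gt0 ?exprn_gt0.
have S0 : 0 <= S by apply: normr_ge0.
have h1 : 2 * (2 * Q + C) / (N ^+ 2 * p) <=
    4 * (S / (N ^+ 2 * p)) + 2 + 2 * (C / (N ^+ 2 * p)).
  move: d0 hQ; move: (N ^+ 2 * p) => d d0 hQ.
  have -> : 4 * (S / d) + 2 + 2 * (C / d) = (4 * S + 2 * d + 2 * C) / d.
    by field; rewrite gt_eqF.
  by apply: ler_wpM2r; [rewrite invr_ge0 ltW | lra].
have h2 : S / (N ^+ 2 * p) <= S / N.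
  by rewrite ler_wpM2l// lef_pV2 ?posrE// expr2 -mulrA ler_peMr// ltW.
(* The cherry contribution 2X becomes 1 + X^2: the mean of X^2 is O(1/N), so it survives summation
   over O(N) nodes, whereas |X| is only known to be of order N^(-1/2). *)
have := sqr_ge0 (C / (N ^+ 2 * p) - 1).
rewrite -[2 * S / N]mulrA -[6 * S / N]mulrA.
move: h1 h2; move: (2 * _ / _) (C / _) (S / (_ * _)) (S / N) (N * p).
by clear=> x1 x2 x3 x4 x5; lra.
Qed.

(** The two edges of a cherry are distinct, so each of the four factors is repeated only if both
    cherries use the same two edges. They then share the center and, up to order, the ends, and the
    mean is at most p^2. *)
Lemma cherry_pair_le p (q r : 'I_n.+1 * 'I_n.+1 * 'I_n.+1) : 0 <= p <= 1 ->
    q.1.2 != q.2 -> r.1.2 != r.2 ->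
  bmean p (fun a => gmx (cent p a) q.1.1 q.1.2 * gmx (cent p a) q.1.1 q.2 *
                    (gmx (cent p a) r.1.1 r.1.2 * gmx (cent p a) r.1.1 r.2)) <=
  ((r == q) + (r == (q.1.1, q.2, q.1.2)))%:R * p ^+ 2.
Proof.
case: q => -[i j] k; case: r => -[i' j'] k' p01 /= jk jk'.
have rhs0 : 0 <= (((i', j', k') == (i, j, k)) + ((i', j', k') == (i, k, j)))%:R * p ^+ 2.
  by rewrite mulr_ge0 ?sqr_ge0.
have zero F : (forall a : {ffun I -> bool}, F a = 0) ->
    bmean p F <= (((i', j', k') == (i, j, k)) + ((i', j', k') == (i, k, j)))%:R * p ^+ 2.
  by move=> F0; rewrite (eq_bmean _ F0) bmean_cst.
case E1: (edge i j) => [e1|]; last by apply: zero => a; rewrite !mxE E1 !mul0r.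
case E2: (edge i k) => [e2|]; last by apply: zero => a; rewrite !mxE E2 mulr0 !mul0r.
case E3: (edge i' j') => [e3|]; last by apply: zero => a; rewrite !mxE E3 mul0r !mulr0.
case E4: (edge i' k') => [e4|]; last by apply: zero => a; rewrite !mxE E4 !mulr0.
have ne12 : e1 != e2.
  apply: contraNneq jk => e12; rewrite -e12 in E2.
  by have [[_ ->]|[-> <-]] := edge_eq E1 E2.
have ne34 : e3 != e4.
  apply: contraNneq jk' => e34; rewrite -e34 in E4.
  by have [[_ ->]|[-> <-]] := edge_eq E3 E4.
rewrite (@eq_bmean _ _ _ _ (fun a => \prod_(e <- [:: e1; e2; e3; e4]) cent p a e)); last first.
  by move=> a; rewrite !mxE E1 E2 E3 E4 !big_cons big_nil /= mulr1 !mulrA.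
apply: le_trans (ler_norm _) _; apply: le_trans (bmean_prod_cent_le _ p01) _.
have [ns|] := boolP (no_singleton _); last by rewrite mul0r.
have cases : (e1 = e3 /\ e2 = e4) \/ (e1 = e4 /\ e2 = e3).
  move: ns; rewrite /no_singleton => /and3P[+ + _]; rewrite ![count_mem _ _]/=.
  have ne21 : e2 != e1 by rewrite eq_sym.
  rewrite !eqxx (negPf ne12) (negPf ne21).
  case: (eqVneq e3 e1) => [->|_]; case: (eqVneq e4 e2) => [->|_]; auto;
    rewrite ?(negPf ne12) ?(negPf ne21)//.
  by case: (eqVneq e4 e1) => // ->; case: (eqVneq e3 e2) => // ->; auto.
have sz : size (undup [:: e1; e2; e3; e4]) = 2%N.
  by case: cases => [[<- <-]|[<- <-]];
    rewrite /= !inE !eqxx ?orbT ?(negPf ne12)//= eq_sym (negPf ne12).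
rewrite sz mul1r ler_peMl ?sqr_ge0// ler1n.
have nij : i != j by apply/eqP => ij; rewrite ij edge_diag in E1.
have nik : i != k by apply/eqP => ik; rewrite ik edge_diag in E2.
case: cases => [[e13 e24]|[e14 e23]].
  rewrite -e13 in E3; rewrite -e24 in E4.
  have [[h1 h2]|[h1 h2]] := edge_eq E1 E3; have [[h3 h4]|[h3 h4]] := edge_eq E2 E4; subst.
  - by rewrite eqxx.
  - by rewrite eqxx in nik.
  - by rewrite eqxx in nij.
  - by rewrite eqxx in jk.
rewrite -e14 in E4; rewrite -e23 in E3.
have [[h1 h2]|[h1 h2]] := edge_eq E1 E4; have [[h3 h4]|[h3 h4]] := edge_eq E2 E3; subst.
- by rewrite eqxx addn1.
- by rewrite eqxx in nik.
- by rewrite eqxx in nij.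
- by rewrite eqxx in jk.
Qed.

Lemma bmean_cherries_sqr_le p : 0 <= p <= 1 ->
  bmean p (fun a => cherries (cent p a) ^+ 2) <= 2 * N ^+ 3 * p ^+ 2.
Proof.
move=> p01.
pose T := ('I_n.+1 * 'I_n.+1 * 'I_n.+1)%type.
pose c a (q : T) := gmx (cent p a) q.1.1 q.1.2 * gmx (cent p a) q.1.1 q.2.
have -> : bmean p (fun a => cherries (cent p a) ^+ 2) =
    \sum_(q : T | q.1.2 != q.2) \sum_(r : T | r.1.2 != r.2) bmean p (fun a => c a q * c a r).
  under [RHS]eq_bigr do rewrite -bmean_sum.
  rewrite -bmean_sum; apply: eq_bmean => a.
  rewrite expr2 {1}/cherries mulr_suml; apply: eq_bigr => q _.
  by rewrite /cherries mulr_sumr.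
apply: (@le_trans _ _ (\sum_(q : T) \sum_(r : T)
    ((r == q) + (r == (q.1.1, q.2, q.1.2)))%:R * p ^+ 2)).
  rewrite big_mkcond; apply: ler_sum => q _; case: ifPn => hq; last first.
    by apply: sumr_ge0 => r _; rewrite mulr_ge0 ?sqr_ge0.
  rewrite big_mkcond; apply: ler_sum => r _; case: ifPn => hr.
    exact: cherry_pair_le.
  by rewrite mulr_ge0 ?sqr_ge0.
have sum1 (r0 : T) : \sum_(r : T) (r == r0)%:R = 1 :> R.
  by rewrite (bigD1 r0)//= eqxx big1 ?addr0// => r /negPf ->.
rewrite (eq_bigr (fun=> 2 * p ^+ 2)); last first.
  move=> q _; rewrite -mulr_suml; congr (_ * _).
  by under eq_bigr do rewrite natrD; rewrite big_split /= !sum1.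
rewrite sumr_const (_ : #|_| = (n.+1 * n.+1 * n.+1)%N); last first.
  by rewrite !card_prod card_ord.
rewrite -[_ *+ _]mulr_natl !natrM le_eqVlt.
by apply/orP; left; apply/eqP; ring.
Qed.

End centered_adjacency.

(** * Trace moments *)

Lemma bin_le_expn n m : ('C(n, m) <= n ^ m)%N.
Proof.
elim: m n => [|m ih] n; first by rewrite bin0.
case: n => [|n]; first by rewrite bin0n.
rewrite expnS -(leq_pmul2l (ltn0Sn m)) -mul_bin_diag mulnCA leq_pmul2l//.
apply: leq_trans (ih n) _; rewrite -[X in (X <= _)%N]mul1n leq_mul//.
by case: m {ih} => // m; rewrite leq_exp2r.
Qed.

Section walks.
Variables (R : realType) (n : nat).
Local Notation I := (pair_of n.+1).
Local Notation V := 'I_n.+1.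
Local Notation N := (n.+1%:R : R).
Implicit Types (x y : V) (s : seq V) (xi : I -> R) (p : R).

Fixpoint walkw (W : 'M[R]_n.+1) x s : R :=
  if s is y :: s' then W x y * walkw W y s' else 1.

Lemma expr_walkw (W : 'M[R]_n.+1) r x y :
  (W ^+ r) x y = \sum_(t : r.-tuple V) walkw W x t * (last x t == y)%:R.
Proof.
elim: r x => [|r ih] x; first by rewrite big_tuple_nil expr0 mxE /= mul1r.
rewrite exprS big_tuple_cons -[W * _]/(W *m _) mxE; apply: eq_bigr => z _.
by rewrite ih mulr_sumr; apply: eq_bigr => t _; rewrite /= mulrA.
Qed.

Lemma walkw_gmx xi x s :
  (exists2 es, pairmap (@edge n.+1) x s = map Some es &
     walkw (gmx xi) x s = \prod_(e <- es) xi e) \/ (None \in pairmap (@edge n.+1) x s).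
Proof.
elim: s x => [|y s ih] x /=; first by left; exists [::]; rewrite ?big_nil.
case E: (edge x y) => [e|]; last by right; rewrite inE eqxx.
have [[es h1 h2]|h] := ih y; last by right; rewrite inE h orbT.
by left; exists (e :: es); rewrite /= ?h1// h2 big_cons mxE E.
Qed.

Lemma walkw_gmx0 xi x s : None \in pairmap (@edge n.+1) x s -> walkw (gmx xi) x s = 0.
Proof.
elim: s x => //= y s ih x; rewrite inE => /orP[/eqP h|/ih ->]; last by rewrite mulr0.
by rewrite mxE -h mul0r.
Qed.

Lemma walk_endpoint x y z s es e : edge x y = Some e ->
  pairmap (@edge n.+1) z s = map Some es -> e \in es -> x \in z :: s.
Proof.
move=> xy; elim: s z es => [|w s ih] z [|e' es] //= [zw hs].
rewrite inE => /orP[/eqP ee|/(ih _ _ hs) xs]; last by rewrite inE xs orbT.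
rewrite -ee in zw; have [[-> _]|[-> _]] := edge_eq xy zw.
  by rewrite inE eqxx.
by rewrite !inE eqxx orbT.
Qed.

(* The first step into a new vertex uses a new edge. *)
Lemma walk_size_undup x s es : pairmap (@edge n.+1) x s = map Some es ->
  (size (undup (x :: s)) <= (size (undup es)).+1)%N.
Proof.
elim: s x es => [|y s ih] x [|e es] //= [xy hs].
have := ih y es hs; have [xin|xnin] := boolP (x \in y :: s).
  by move=> /= /leq_trans; apply; case: ifP.
have -> : e \in es = false.
  by apply/negP => /(walk_endpoint xy hs); rewrite (negPf xnin).
by [].
Qed.

Lemma no_singleton_size (T : finType) (es : seq T) : no_singleton es ->
  ((size (undup es)).*2 <= size es)%N.
Proof.
move=> /allP ns; have -> : size es = (\sum_i count_mem i es)%N.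
  elim: es {ns} => [|e es ih] /=; first by rewrite big1.
  rewrite big_split /= -ih (bigD1 e)//= eqxx big1 ?addn0// => i /negPf.
  by rewrite eq_sym => ->.
have -> : size (undup es) = (\sum_i (i \in es))%N.
  rewrite -(card_uniqP (undup_uniq es)) -sum1_card big_mkcond.
  by apply: eq_bigr => i _; rewrite mem_undup; case: (i \in es).
rewrite -muln2 big_distrl; apply: leq_sum => i _ /=.
by have [ie|//] := boolP (i \in es); rewrite mul1n ns.
Qed.

(** Only walks using each of their edges at least twice contribute; they have at most [k] distinct
    edges, hence at most [k + 1] distinct vertices. Trading the number of edges for the number of
    vertices minus 1 in the exponent is allowed as p <= 1. *)
Lemma bmean_walkw_le p k x s : 0 <= p <= 1 -> size s = k.*2 ->
  `|bmean p (fun a => walkw (gmx (cent p a)) x s)| <=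
  (size (undup (x :: s)) <= k.+1)%N%:R * p ^+ (size (undup (x :: s))).-1.
Proof.
move=> p01 sk; have p0 : 0 <= p by case/andP: p01.
have rhs0 : 0 <= (size (undup (x :: s)) <= k.+1)%N%:R * p ^+ (size (undup (x :: s))).-1.
  by rewrite mulr_ge0// exprn_ge0.
have [hN|hN] := boolP (None \in pairmap (@edge n.+1) x s).
  rewrite (@eq_bmean _ _ _ _ (fun=> 0)) ?bmean_cst ?normr0// => a.
  exact: walkw_gmx0.
have [[es es1 _]|] := walkw_gmx (fun=> 0) x s; last by rewrite (negPf hN).
rewrite (@eq_bmean _ _ _ _ (fun a => \prod_(e <- es) cent p a e)); last first.
  move=> a; have [[es' es1' ->]|] := walkw_gmx (cent p a) x s; last by rewrite (negPf hN).
  by congr (\prod_(e <- _) _); apply: (inj_map Some_inj); rewrite -es1 -es1'.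
apply: le_trans (bmean_prod_cent_le _ p01) _.
have [ns|] := boolP (no_singleton es); last by rewrite mul0r.
have h1 := no_singleton_size ns; have h2 := walk_size_undup es1.
have h3 : size es = k.*2.
  by rewrite -sk -(size_pairmap (@edge n.+1) x s) es1 size_map.
have -> : (size (undup (x :: s)) <= k.+1)%N.
  by apply: leq_trans h2 _; rewrite ltnS -leq_double -h3.
rewrite !mul1r; apply: ler_wiXn2l => //; first by case/andP: p01.
by move: h2; case: (size _).
Qed.

Lemma sum_tuple_all (S : {set V}) r :
  \sum_(t : r.-tuple V) (all (mem S) t)%:R = #|S|%:R ^+ r :> R.
Proof.
elim: r => [|r ih]; first by rewrite big_tuple_nil expr0.
rewrite big_tuple_cons exprS -ih -sum1_card natr_sum mulr_suml [RHS]big_mkcond.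
apply: eq_bigr => x _ /=; case: ifP => /= xS; last by rewrite big1.
by rewrite mul1r.
Qed.

Lemma sum_small_sets p k : 0 <= p -> 1 <= N * p ->
  \sum_(S : {set V} | (0 < #|S| <= k.+1)%N) p ^+ #|S|.-1 <= N * k.+1%:R * (N * p) ^+ k.
Proof.
move=> p0 Np.
apply: (@le_trans _ _ (\sum_(c < k.+1) 'C(n.+1, c.+1)%:R * p ^+ c)).
  rewrite (partition_big (fun S : {set V} => (inord #|S|.-1 : 'I_k.+1)) xpredT)//=.
  apply: ler_sum => c _.
  rewrite -[X in 'C(X, _)](card_ord n.+1) -card_draws -sum1_card natr_sum mulr_suml.
  rewrite big_mkcond [leRHS]big_mkcond; apply: ler_sum => S _.
  have [/andP[/andP[S0 Sk] /eqP Sc]|_] := boolP (_ && _).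
    have Sc1 : #|S| = c.+1.
      by rewrite -Sc inordK ?prednK//; rewrite -ltnS prednK.
    by rewrite inE Sc1 eqxx mul1r.
  by case: ifP => // _; rewrite mul1r exprn_ge0.
apply: (@le_trans _ _ (\sum_(c < k.+1) N * (N * p) ^+ k)).
  apply: ler_sum => c _.
  apply: (@le_trans _ _ (N ^+ c.+1 * p ^+ c)).
    by rewrite ler_wpM2r ?exprn_ge0// -natrX ler_nat bin_le_expn.
  rewrite exprS -mulrA -exprMn ler_wpM2l// ler_weXn2l// -ltnS.
  exact: ltn_ord.
by rewrite sumr_const card_ord -[_ *+ _]mulr_natr mulrAC.
Qed.

(** Each contributing walk is charged to its vertex set [S], and the walks inside [S] are counted by
    all tuples of length 2k+1 over [S], forgetting that they are closed. The excess (k+1)^(2k+2) is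
    affordable because N p will exceed a multiple of (k+1)^2. *)
Lemma bmean_trace_pow_le p k : 0 <= p <= 1 -> 1 <= N * p ->
  bmean p (fun a : {ffun I -> bool} => \tr (gmx (cent p a) ^+ k.*2)) <=
  N * k.+1%:R ^+ (k.+1).*2 * (N * p) ^+ k.
Proof.
move=> p01 Np; have p0 : 0 <= p by case/andP: p01.
pose c (t : seq V) := size (undup t).
apply: (@le_trans _ _ (\sum_(t : k.*2.+1.-tuple V) (c t <= k.+1)%N%:R * p ^+ (c t).-1)).
  rewrite big_tuple_cons bmean_sum; apply: ler_sum => x _.
  rewrite (@eq_bmean _ _ _ _ (fun a : {ffun I -> bool} => \sum_(t : k.*2.-tuple V)
    walkw (gmx (cent p a)) x t * (last x t == x)%:R)); last first.
    by move=> a; rewrite expr_walkw.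
  rewrite bmean_sum; apply: ler_sum => t _.
  apply: le_trans (bmean_walkw_le x p01 (size_tuple t)).
  rewrite (@eq_bmean _ _ _ _
    (fun a => (last x t == x)%:R * walkw (gmx (cent p a)) x t)); last first.
    by move=> a; rewrite mulrC.
  by rewrite bmeanZ; case: eqP => _; rewrite ?mul1r ?mul0r ?ler_norm.
apply: (@le_trans _ _ (\sum_(t : k.*2.+1.-tuple V)
    \sum_(S : {set V} | (0 < #|S| <= k.+1)%N) (all (mem S) t)%:R * p ^+ #|S|.-1)).
  apply: ler_sum => t _.
  have term0 (S : {set V}) : 0 <= (all (mem S) t)%:R * p ^+ #|S|.-1.
    by rewrite mulr_ge0// exprn_ge0.
  have [ck|_] := boolP (c t <= k.+1)%N; last by rewrite mul0r sumr_ge0.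
  pose S := [set y in (t : seq V)]%SET.
  have cS : #|S| = c t.
    rewrite /c -(card_uniqP (undup_uniq t)); apply: eq_card => y.
    by rewrite inE mem_undup.
  have St : all (mem S) t by apply/allP => y yt; rewrite /= inE.
  rewrite (bigD1 S)/=; last first.
    rewrite cS ck andbT -cS card_gt0; apply/set0Pn; exists (thead t).
    by rewrite inE /thead mem_tnth.
  by rewrite St cS lerDl sumr_ge0.
rewrite exchange_big /=.
apply: (@le_trans _ _ (\sum_(S : {set V} | (0 < #|S| <= k.+1)%N)
    k.+1%:R ^+ k.*2.+1 * p ^+ #|S|.-1)).
  apply: ler_sum => S /andP[_ Sk]; rewrite -mulr_suml sum_tuple_all.
  by rewrite ler_wpM2r ?exprn_ge0// lerXn2r ?nnegrE// ler_nat.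
rewrite -mulr_sumr.
apply: le_trans (ler_wpM2l _ (sum_small_sets k p0 Np)) _; first by rewrite exprn_ge0.
rewrite doubleS [in leRHS]exprS.
by move: (_ ^+ k.*2.+1) ((N * p) ^+ k) => A B; rewrite le_eqVlt; apply/orP; left; apply/eqP; ring.
Qed.

End walks.

(** * Chaining and the dense regime at a fixed p *)

Section chaining.
Variable R : realType.

(** Peel off the finest level: the even points form the previous dyadic grid, and an odd point is
    one finest increment away from an even one. *)
Lemma dyadic_chaining K (F : nat -> R) (M : nat -> R) :
    (forall k i, (k <= K)%N -> (i < 2 ^ k)%N ->
       `|F (i.+1 * 2 ^ (K - k))%N - F (i * 2 ^ (K - k))%N| <= M k) ->
  forall j, (j <= 2 ^ K)%N -> `|F j| <= `|F 0%N| + \sum_(k < K.+1) M k.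
Proof.
elim: K F => [|K ih] F hM j jK.
  rewrite big_ord_recl big_ord0 addr0.
  have := hM 0%N 0%N isT isT; rewrite subnn expn0 !muln1 => h.
  case: j jK => [|[|//]] _ /=; first by rewrite lerDl (le_trans _ h).
  by have := ler_normD (F 0%N) (F 1%N - F 0%N); rewrite subrKC; lra.
rewrite big_ord_recr /=.
have hF k i : (k <= K)%N -> (i < 2 ^ k)%N ->
    `|F (i.+1 * 2 ^ (K - k)).*2 - F (i * 2 ^ (K - k)).*2| <= M k.
  move=> kK ik; have := hM k i (leqW kK) ik.
  by rewrite subSn// expnS !(mulnCA _ 2%N) !mul2n.
have ih' l : (l <= 2 ^ K)%N -> `|F l.*2| <= `|F 0%N| + \sum_(k < K.+1) M k.
  by move=> lK; apply: (ih (F \o double)) => // k i kK ik; exact: hF.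
have MK i : (i < 2 ^ K.+1)%N -> `|F i.+1 - F i| <= M K.+1.
  by move=> iK; have := hM K.+1 i (leqnn _) iK; rewrite subnn expn0 !muln1.
have h := odd_double_half j; set l := j./2 in h.
have jK2 : (j <= (2 ^ K).*2)%N by rewrite -mul2n -expnS.
have lK : (l <= 2 ^ K)%N by rewrite -leq_double; apply: leq_trans jK2; lia.
have MK0 : 0 <= M K.+1 by apply: le_trans (MK 0%N _); rewrite ?expn_gt0.
case: (odd j) h => h; rewrite -h; last by have := ih' l lK; rewrite add0n; lra.
have := ler_normD (F l.*2) (F l.*2.+1 - F l.*2); rewrite subrKC add1n.
have := MK l.*2; rewrite expnS mul2n => /(_ ltac:(lia)); have := ih' l lK; lra.
Qed.

(** This turns the maximum of finitely many variables into [c] plus a sum of fourth powers, whose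
    mean is computable. *)
Lemma norm_le_add_pow4 (c x : R) : 0 < c -> `|x| <= c + x ^+ 4 / c ^+ 3.
Proof.
move=> c0; have x4 : 0 <= x ^+ 4 by rewrite (exprM x 2 2) sqr_ge0.
have c3 : 0 < c ^+ 3 by rewrite exprn_gt0.
have [xc|/ltW cx] := leP `|x| c.
  by apply: le_trans xc _; rewrite lerDl divr_ge0// ltW.
apply: (@le_trans _ _ (x ^+ 4 / c ^+ 3)); last by rewrite lerDr ltW.
rewrite ler_pdivlMr//.
have -> : x ^+ 4 = `|x| * `|x| ^+ 3.
  by rewrite -exprS -normrX ger0_norm.
by rewrite ler_wpM2l// lerXn2r// nnegrE ltW.
Qed.

Lemma geometric_sum_le (r : R) m : 0 <= r < 1 -> \sum_(k < m) r ^+ k <= (1 - r)^-1.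
Proof.
move=> r01; have r1 : 0 < 1 - r by lra.
rewrite -[leRHS]div1r ler_pdivlMr// mulrC -opprB mulNr -subrX1.
by rewrite opprB lerBlDr lerDl exprn_ge0//; case/andP: r01.
Qed.

End chaining.

Section dense_regime.
Variables (R : realType) (n : nat).
Local Notation I := (pair_of n.+1).
Local Notation N := (n.+1%:R : R).
Implicit Types (a : {ffun I -> bool}) (p : R).

Lemma trace_pow_double_ge0 (xi : I -> R) k : 0 <= \tr (gmx xi ^+ k.*2).
Proof.
have -> : gmx xi ^+ k.*2 = gmx xi ^+ k *m (gmx xi ^+ k)^T.
  by rewrite trmx_exp gmx_sym -addnn exprD.
apply: sumr_ge0 => i _; rewrite mxE; apply: sumr_ge0 => j _.
by rewrite !mxE -expr2 sqr_ge0.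
Qed.

Definition cherry_term p a : R := (cherries (cent p a) / (N ^+ 2 * p)) ^+ 2.

Definition trace_term (k : nat) p a : R :=
  N * \tr (gmx (cent p a) ^+ k.*2) / (N * p / 4) ^+ k.*2.

Lemma cherry_term_ge0 p a : 0 <= cherry_term p a.
Proof. exact: sqr_ge0. Qed.

Lemma trace_term_ge0 k p a : 0 <= trace_term k p a.
Proof.
rewrite /trace_term divr_ge0 ?mulr_ge0 ?trace_pow_double_ge0//.
by rewrite -muln2 exprM sqr_ge0.
Qed.

(* When the spectral norm is too large, [trace_term] exceeds the trivial
   bound [N]. *)
Lemma glam_near_mean p a s : 0 <= p <= 1 -> 1 <= N * p ->
  `|glam (real_config R a) - N * p| <=
  5 + 6 * `|\sum_e cent p a e| / N + cherry_term p a + trace_term (2 ^ s) p a.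
Proof.
move=> p01 Np; have N0 : 0 < N by [].
have h1 := cherry_term_ge0 p a; have h2 := trace_term_ge0 (2 ^ s) p a.
set S := `|\sum_e _|; have S0 : 0 <= S / N by rewrite divr_ge0 ?normr_ge0.
have lam0 := glam_ge0 (real_config R a).
have lamN : glam (real_config R a) <= N.
  by apply: glam_le_order => e; rewrite /real_config; case: (a e); rewrite ?lexx ?ler01.
rewrite -mulrA ler_norml; apply/andP; split.
  (* Lower bound: the Rayleigh quotient at the all-ones vector is N p - p + 2 S / N with S the
     centered edge count. *)
  have := glam_ge (real_config R a) (const_mx 1).
  rewrite (real_configE p) dotv_gmx_shift !dotv_one_one.
  have -> : dotv (const_mx 1 *m gmx (cent p a)) (const_mx 1) = 2 * \sum_e cent p a e.
    by rewrite dotv_gmx; congr (_ * _); apply: eq_bigr => e _; rewrite !mxE !mulr1.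
  rewrite -real_configE => h.
  have : N * p - p + 2 * ((\sum_e cent p a e) / N) <= glam (real_config R a).
    rewrite -(ler_pM2r N0); apply: le_trans h.
    rewrite le_eqVlt; apply/orP; left; apply/eqP.
    by field; rewrite gt_eqF.
  have : - (S / N) <= (\sum_e cent p a e) / N.
    rewrite -mulNr ler_wpM2r//.
    by have := ler_norm (- \sum_e cent p a e); rewrite normrN -/S; lra.
  move: h1 h2 S0; move: (S / N) ((\sum_e cent p a e) / N) (cherry_term p a) (trace_term _ p a).
  by move: (N * p) (glam _) p01; clear=> x1 x2 p01 x3 x4 x5 x6; lra.
have d0 : 0 <= N * p / 4 by lra.
have [good|bad] := leP (\tr (gmx (cent p a) ^+ (2 ^ s.+1))) ((N * p / 4) ^+ (2 ^ s.+1)).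
  have hW z := dotv_le_of_trace_pow z (gmx_sym (cent p a)) d0 good.
  have := glam_upper_cent p01 Np hW; rewrite -/(cherry_term p a) -/S -mulrA.
  move: h2; move: (S / N) (cherry_term p a) (trace_term _ p a) (N * p) (glam _).
  by clear=> x1 x2 x3 x4 x5; lra.
have : N <= trace_term (2 ^ s) p a.
  rewrite /trace_term -mul2n -expnS ler_pdivlMr ?exprn_gt0//; last by lra.
  by rewrite ler_wpM2l// ltW.
have : N * p >= 0 by lra.
move: h1 h2 S0 lam0 lamN.
move: (S / N) (cherry_term p a) (trace_term _ p a) (N * p) (glam _) (N).
by clear=> x1 x2 x3 x4 x5 x6; lra.
Qed.

Lemma bmean_cherry_term_le p : 0 < p <= 1 -> bmean p (cherry_term p) <= 2 / N.
Proof.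
move=> p01; have p01' : 0 <= p <= 1 by lra.
have p0 : 0 < p by lra.
have d0 : 0 < N ^+ 2 * p by rewrite mulr_gt0// exprn_gt0.
have -> : bmean p (cherry_term p) =
    ((N ^+ 2 * p) ^-1) ^+ 2 * bmean p (fun a => cherries (cent p a) ^+ 2).
  by rewrite -bmeanZ; apply: eq_bmean => a; rewrite /cherry_term exprMn mulrC.
apply: le_trans (ler_wpM2l _ (bmean_cherries_sqr_le _ p01')) _; first exact: sqr_ge0.
rewrite le_eqVlt; apply/orP; left; apply/eqP; field.
by rewrite !gt_eqF.
Qed.

(** With c = (k+1)^2 the mean is at most N^2 c (16 c / (N p))^k. Since 512 = 16 * 32, the last
    factor is at most 32^(-k), which pays for N^3 <= 8^k and c <= 4^k. *)
Lemma bmean_trace_term_le p k : 0 <= p <= 1 -> (0 < k)%N -> (n.+1 <= 2 ^ k)%N ->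
  512 * k.+1%:R ^+ 2 <= N * p -> bmean p (trace_term k p) <= 1 / N.
Proof.
move=> p01 k0 Nk hp; set y := N * p in hp.
have N0 : 0 < N by [].
have k1 : 1 <= k.+1%:R ^+ 2 :> R by rewrite exprn_ege1// ler1n.
have y0 : 0 < y by lra.
have q0 : 0 < (y / 4) ^+ k.*2 by rewrite exprn_gt0// divr_gt0.
have -> : bmean p (trace_term k p) =
    N / (y / 4) ^+ k.*2 * bmean p (fun a => \tr (gmx (cent p a) ^+ k.*2)).
  by rewrite -bmeanZ; apply: eq_bmean => a; rewrite /trace_term mulrAC.
have Np : 1 <= N * p by rewrite -/y; lra.
apply: le_trans (ler_wpM2l _ (bmean_trace_pow_le k p01 Np)) _.
  by rewrite divr_ge0// ltW.
set c : R := k.+1%:R ^+ 2 in hp k1.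
have -> : N / (y / 4) ^+ k.*2 * (N * k.+1%:R ^+ (k.+1).*2 * (N * p) ^+ k) =
    N ^+ 2 * c * (16 * c / y) ^+ k.
  rewrite -/y -!muln2 !(mulnC _ 2%N) !exprM -/c [c ^+ k.+1]exprS.
  have -> : 16 * c / y = c * y / (y / 4) ^+ 2 by field; rewrite gt_eqF.
  rewrite !(exprMn, exprVn).
  have p0 : p != 0 by apply: contraTneq y0 => p0; rewrite /y p0 mulr0 ltxx.
  by field; rewrite !expf_neq0.
have hq : 16 * c / y <= 32^-1.
  by rewrite ler_pdivrMr//; lra.
have ck : c <= 4 ^+ k.
  rewrite /c -!natrX ler_nat -[4%N]/(2 ^ 2)%N -expnM mulnC expnM leq_exp2r//.
  by rewrite ltn_expl.
have N3 : N ^+ 3 <= (2 ^+ k) ^+ 3.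
  by rewrite lerXn2r ?nnegrE// -natrX ler_nat.
have h32 : (16 * c / y) ^+ k <= (32^-1) ^+ k.
  rewrite lerXn2r ?nnegrE ?invr_ge0// divr_ge0 ?mulr_ge0 ?(ltW y0)//; lra.
rewrite ler_pdivlMr//.
have -> : N ^+ 2 * c * (16 * c / y) ^+ k * N = N ^+ 3 * (c * (16 * c / y) ^+ k) by ring.
have hc : c * (16 * c / y) ^+ k <= 4 ^+ k * (32^-1) ^+ k.
  by rewrite ler_pM// ?exprn_ge0 ?divr_ge0 ?mulr_ge0 ?(ltW y0)//; lra.
have hc0 : 0 <= c * (16 * c / y) ^+ k.
  by rewrite mulr_ge0 ?exprn_ge0 ?divr_ge0 ?mulr_ge0 ?(ltW y0)//; lra.
apply: le_trans (ler_pM _ hc0 N3 hc) _; first by rewrite exprn_ge0.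
rewrite exprAC -!exprMn (_ : _ * _ = 1) ?expr1n//; lra.
Qed.

Lemma bmean_increment_pow4_le (b : R) : 0 <= b <= 1 -> 1 <= N ^+ 2 * b ->
  bmean b (fun a => (\sum_e cent b a e) ^+ 4) <= 2 * (N ^+ 2 * b) ^+ 2.
Proof.
move=> b01 Nb; apply: le_trans (bmean_centered_sum_pow4 _ b01) _.
set M : R := #|_|%:R.
have hM : 2 * M <= N ^+ 2.
  by rewrite /M -natrX -natrM ler_nat mulnC card_pair_of_le.
have M0 : 0 <= M by [].
have : 2 * (M * b) <= N ^+ 2 * b by rewrite mulrA ler_wpM2r//; lra.
have : 0 <= M * b by rewrite mulr_ge0//; lra.
move: Nb; move: (N ^+ 2 * b) (M * b) => x y; nra.
Qed.

End dense_regime.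

(** * The random configuration *)

Section has_mean.
Context (d : measure_display) (T : measurableType d) (R : realType).
Variable P : probability T R.
Implicit Types (f g : T -> R) (m c : R).

(* No measurability: the supremum over all [p] is not known to be measurable. *)
Lemma le_integral_nonmeasurable (f g : T -> \bar R) :
    (forall w, 0 <= f w)%E -> (forall w, f w <= g w)%E ->
  (\int[P]_w f w <= \int[P]_w g w)%E.
Proof.
move=> f0 fg; have g0 w : (0 <= g w)%E by apply: le_trans (f0 w) (fg w).
rewrite !ge0_integralTE//; apply: le_ereal_sup => _ [h hf <-].
by exists h => // w; apply: le_trans (hf w) (fg w).
Qed.

(** Restricting to nonnegative measurable functions with a real mean makes sums and nonnegative
    multiples free of integrability side conditions. *)
Definition has_mean f m : Prop :=
  [/\ measurable_fun [set: T]%classic f, forall w, 0 <= f w &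
      (\int[P]_w (f w)%:E = m%:E)%E].

Lemma has_meanD f g m1 m2 : has_mean f m1 -> has_mean g m2 ->
  has_mean (fun w => f w + g w) (m1 + m2).
Proof.
move=> [mf f0 fm] [mg g0 gm]; split.
- exact: measurable_funD.
- by move=> w; rewrite addr_ge0.
under eq_integral do rewrite EFinD.
rewrite ge0_integralD//= ?fm ?gm//.
- by move=> w _; rewrite lee_fin.
- exact/measurable_EFinP.
- by move=> w _; rewrite lee_fin.
- exact/measurable_EFinP.
Qed.

Lemma has_meanZ c f m : 0 <= c -> has_mean f m -> has_mean (fun w => c * f w) (c * m).
Proof.
move=> c0 [mf f0 fm]; split.
- exact: measurable_funM.
- by move=> w; rewrite mulr_ge0.
under eq_integral do rewrite EFinM.
rewrite ge0_integralZl_EFin//= ?fm ?EFinM//.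
- by move=> w _; rewrite lee_fin.
- exact/measurable_EFinP.
Qed.

Lemma has_mean_cst c : 0 <= c -> has_mean (fun=> c) c.
Proof.
move=> c0; split=> //.
have P1 : P [set: T]%classic = 1%E by exact: probability_setT.
by rewrite (integral_cst P measurableT c%:E) [X in (_ * X)%E]P1 mule1.
Qed.

Lemma has_mean_sum (J : Type) (r : seq J) (Q : pred J) (f : J -> T -> R) (m : J -> R) :
    (forall j, Q j -> has_mean (f j) (m j)) ->
  has_mean (fun w => \sum_(j <- r | Q j) f j w) (\sum_(j <- r | Q j) m j).
Proof.
move=> h; elim: r => [|j r ih].
  rewrite big_nil; under eq_fun do rewrite big_nil.
  exact: has_mean_cst.
rewrite big_cons; under eq_fun do rewrite big_cons.
by case: ifPn => // Qj; apply: has_meanD => //; exact: h.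
Qed.

Lemma has_mean_le f g m1 m2 : has_mean f m1 -> has_mean g m2 ->
  (forall w, f w <= g w) -> m1 <= m2.
Proof.
move=> [mf f0 fm] [mg g0 gm] fg; rewrite -lee_fin -fm -gm.
by apply: le_integral_nonmeasurable => w; rewrite lee_fin.
Qed.

End has_mean.

Section uniform_law.
Variable R : realType.

Lemma uniform_probE (B : set R) : measurable B ->
  uniform_prob (@ltr01 R) B = lebesgue_measure (B `&` `[0, 1])%classic.
Proof.
move=> mB; rewrite /uniform_prob integral_uniform_pdf.
rewrite (eq_integral (fun=> 1%:E)); last first.
  move=> x; rewrite inE /= => -[_]; rewrite in_itv /= => x01.
  by rewrite /uniform_pdf x01 subr0 invr1.
by rewrite integral_cst ?mul1e//; apply: measurableI.
Qed.

Lemma uniform_prob_ltr (p : R) : 0 <= p <= 1 ->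
  uniform_prob (@ltr01 R) (`]-oo, p[)%classic = p%:E.
Proof.
move=> /andP[p0 p1]; rewrite uniform_probE//.
have -> : (`]-oo, p[ `&` `[0, 1] = `[0%R, p[ :> set R)%classic.
  apply/seteqP; split=> x /=; rewrite !in_itv /=; lra.
rewrite lebesgue_measure_itv /= lte_fin; case: ltP => h; first by rewrite oppr0 addr0.
by congr (_%:E); lra.
Qed.

Lemma uniform_prob_itvco (p q : R) : 0 <= p -> p <= q -> q <= 1 ->
  uniform_prob (@ltr01 R) (`[p, q[)%classic = (q - p)%:E.
Proof.
move=> p0 pq q1; rewrite uniform_probE//.
have -> : (`[p, q[ `&` `[0, 1] = `[p, q[ :> set R)%classic.
  apply/seteqP; split=> x /=; rewrite !in_itv /=; lra.
rewrite lebesgue_measure_itv /= lte_fin; case: ltP => h; first by rewrite EFinB.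
by congr (_%:E); lra.
Qed.

End uniform_law.

Section random_configuration.
Context (d : measure_display) (T : measurableType d) (R : realType).
Variables (P : probability T R) (n : nat) (U : 'I_n -> 'I_n -> {RV P >-> R}).
Hypothesis U_uniform : forall i j : 'I_n, (i < j)%N -> uniform01 (U i j).
Hypothesis U_indep : mutually_independent (upper_pairs n)
  (fun e : 'I_n * 'I_n => U e.1 e.2).
Local Notation I := (pair_of n).

(** A general set [B] covers both the graph at [p], with the half-line below [p], and the edges
    appearing between [p] and [q], with the interval [[p, q[]. *)
Definition cfg (B : set R) (w : T) : {ffun I -> bool} :=
  [ffun e => U (val e).1 (val e).2 w \in B].

(** Independence is applied to all upper pairs at once, the event for each edge being [B] or its
    complement according to [a]. *)
Lemma has_mean_cfg_eq (B : set R) b (a : {ffun I -> bool}) : measurable B ->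
    uniform_prob (@ltr01 R) B = b%:E -> 0 <= b <= 1 ->
  has_mean P (fun w => (cfg B w == a)%:R) (\prod_e bern b (a e)).
Proof.
move=> mB Bb b01.
pose C (q : 'I_n * 'I_n) : set R :=
  if insub q is Some e then (if a e then B else ~` B)%classic else [set: R]%classic.
have mC q : measurable (C q).
  by rewrite /C; case: insubP => // e _ _; case: (a e) => //; exact: measurableC.
pose Ev := (\bigcap_(q in [set` upper_pairs n]) (U q.1 q.2 @^-1` C q))%classic.
have mU i j D : measurable D -> measurable (U i j @^-1` D)%classic.
  by move=> mD; rewrite -[X in measurable X]setTI; apply: measurable_funP.
have mEv : measurable Ev.
  by apply: fin_bigcap_measurable => // q _; apply: mU.
have EvE w : (cfg B w == a)%:R = \1_Ev w :> R.
  rewrite indicE; congr (_%:R); congr nat_of_bool; apply/eqP/idP => [wa|].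
    rewrite inE => q /= qup; rewrite /C insubT /= -wa ffunE /=.
    by case: ifPn; rewrite ?inE// notin_setE.
  rewrite inE => h; apply/ffunP => e; rewrite ffunE.
  have := h (val e) (valP e); rewrite /C valK /=.
  by case: (a e) => /= hB; [rewrite mem_set|rewrite memNset].
split=> [||].
- by under eq_fun do rewrite EvE; apply: measurable_indic.
- by move=> w.
under eq_integral do rewrite EvE.
rewrite integral_indic// setIT.
transitivity (\prod_(q in upper_pairs n) P (U q.1 q.2 @^-1` C q)%classic)%E.
  exact: U_indep (fintype.subxx _) (fun q _ => mC q).
rewrite big_sub -prodEFin; apply: eq_bigr => e _.
rewrite /C valK; have := valP e; rewrite inE /= => lte.
have PB : P (U (val e).1 (val e).2 @^-1` B)%classic = b%:E.
  by rewrite -Bb -(U_uniform lte mB).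
case: (a e) => /=; first exact: PB.
by rewrite preimage_setC probability_setC ?PB ?EFinB//; apply: mU.
Qed.

Lemma has_mean_cfg (B : set R) b (G : {ffun I -> bool} -> R) : measurable B ->
    uniform_prob (@ltr01 R) B = b%:E -> 0 <= b <= 1 -> (forall a, 0 <= G a) ->
  has_mean P (fun w => G (cfg B w)) (bmean b G).
Proof.
move=> mB Bb b01 G0.
have -> : (fun w => G (cfg B w)) =
    (fun w => \sum_(a : {ffun I -> bool}) G a * (cfg B w == a)%:R).
  apply/funext => w; rewrite (bigD1 (cfg B w))//= eqxx mulr1 big1 ?addr0//.
  by move=> a; rewrite eq_sym => /negPf ->; rewrite mulr0.
rewrite /bmean; under [in X in has_mean _ _ X]eq_bigr do rewrite mulrC.
by apply: has_mean_sum => a _; apply: has_meanZ => //; exact: has_mean_cfg_eq.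
Qed.

Definition cfg_below (p : R) (w : T) := cfg `]-oo, p[%classic w.

Lemma has_mean_cfg_below p (G : {ffun I -> bool} -> R) :
    0 <= p <= 1 -> (forall a, 0 <= G a) ->
  has_mean P (fun w => G (cfg_below p w)) (bmean p G).
Proof. by move=> p01 G0; apply: has_mean_cfg => //; exact: uniform_prob_ltr. Qed.

Lemma cfg_below_mono p q w e : p <= q ->
  0 <= real_config R (cfg_below p w) e <= real_config R (cfg_below q w) e.
Proof.
move=> pq; rewrite /real_config !ffunE ler0n ler_nat /=.
have [|//] := boolP (_ \in `]-oo, p[%classic); rewrite inE /= in_itv /= => h.
by rewrite mem_set//= in_itv /= (lt_le_trans h).
Qed.

Lemma er_lambdaE p w :
  er_lambda U p w = largest_eigenvalue (gmx (real_config R (cfg_below p w))).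
Proof.
rewrite /er_lambda; congr largest_eigenvalue; apply/matrixP => i j; rewrite !mxE.
have cE (k l : 'I_n) (kl : (k, l) \in upper_pairs n) :
    real_config R (cfg_below p w) (exist _ (k, l) kl) = (U k l w < p)%R%:R.
  rewrite /real_config ffunE /=; congr (_%:R); congr nat_of_bool.
  by apply/idP/idP; rewrite inE /= in_itv.
case: ltngtP => ij.
- have ij' : (i, j) \in upper_pairs n by rewrite inE.
  by rewrite (edge_lt ij') /= cE.
- have ij' : (j, i) \in upper_pairs n by rewrite inE.
  by rewrite edge_sym (edge_lt ij') /= cE.
by rewrite (val_inj ij) edge_diag.
Qed.

(** An increment of the centered edge count is itself a centered Bernoulli sum, of parameter
    [q - p], so the same fourth moment estimate serves in the chaining. *)
Lemma sum_cent_cfg_increment p q w : p <= q ->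
  \sum_e cent q (cfg_below q w) e - \sum_e cent p (cfg_below p w) e =
  \sum_e cent (q - p) (cfg `[p, q[%classic w) e.
Proof.
move=> pq; rewrite -sumrB; apply: eq_bigr => e _; rewrite /cent !ffunE.
set x := U _ _ w.
have -> : (x \in `]-oo, q[%classic) = (x < q) by apply/idP/idP; rewrite inE /= in_itv.
have -> : (x \in `]-oo, p[%classic) = (x < p) by apply/idP/idP; rewrite inE /= in_itv.
have -> : (x \in `[p, q[%classic) = (p <= x) && (x < q).
  by apply/idP/idP; rewrite inE /= in_itv.
have [xp|px] := ltP x p; first by rewrite (lt_le_trans xp pq) /=; ring.
by case: ltP => _ /=; ring.
Qed.

End random_configuration.

(** * The sparse regime *)

Section mean_le.
Context (d : measure_display) (T : measurableType d) (R : realType).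
Variable P : probability T R.
Implicit Types (f g : T -> R) (m c : R).

Definition mean_le f c : Prop := exists2 m, has_mean P f m & m <= c.

Lemma mean_le_trans f c c' : mean_le f c -> c <= c' -> mean_le f c'.
Proof. by move=> [m fm mc] cc'; exists m => //; apply: le_trans cc'. Qed.

Lemma mean_leD f g c1 c2 : mean_le f c1 -> mean_le g c2 ->
  mean_le (fun w => f w + g w) (c1 + c2).
Proof.
by move=> [m1 fm1 h1] [m2 gm2 h2]; exists (m1 + m2); [exact: has_meanD|exact: lerD].
Qed.

Lemma mean_leZ c f m : 0 <= c -> mean_le f m -> mean_le (fun w => c * f w) (c * m).
Proof.
by move=> c0 [m1 fm1 h1]; exists (c * m1); [exact: has_meanZ|exact: ler_wpM2l].
Qed.

Lemma mean_le_cst c : 0 <= c -> mean_le (fun=> c) c.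
Proof. by move=> c0; exists c => //; exact: has_mean_cst. Qed.

Lemma mean_le_sum (J : Type) (r : seq J) (Q : pred J) (f : J -> T -> R) (m : J -> R) :
    (forall j, Q j -> mean_le (f j) (m j)) ->
  mean_le (fun w => \sum_(j <- r | Q j) f j w) (\sum_(j <- r | Q j) m j).
Proof.
move=> h; elim: r => [|j r ih].
  rewrite big_nil; under eq_fun do rewrite big_nil.
  exact: mean_le_cst.
rewrite big_cons; under eq_fun do rewrite big_cons.
by case: ifPn => // Qj; apply: mean_leD => //; exact: h.
Qed.

Lemma mean_le_ge0 f c : mean_le f c -> forall w, 0 <= f w.
Proof. by case=> m []. Qed.

End mean_le.

Section mean_polynomial.
Variables (R : realType) (I : finType).

(** Gives access to the intermediate value theorem for polynomials, by which the sparse grid is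
    built. *)
Lemma bmean_polynomial (G : {ffun I -> bool} -> R) :
  exists q : {poly R}, forall p, bmean p G = q.[p].
Proof.
exists (\sum_(a : {ffun I -> bool}) (\prod_i (if a i then 'X else 1 - 'X)) * (G a)%:P) => p.
rewrite horner_sum; apply: eq_bigr => a _; rewrite hornerM hornerC; congr (_ * _).
rewrite horner_prod; apply: eq_bigr => i _; rewrite /bern.
by case: (a i); rewrite !hornerE.
Qed.

(* The points are the preimages of the integers in the range of [q], together
   with both endpoints. *)
Lemma unit_increment_grid (q : {poly R}) (p0 : R) (L : nat) : 0 <= p0 ->
    (forall x y, 0 <= x -> x <= y -> y <= p0 -> q.[x] <= q.[y]) ->
    0 <= q.[0] -> q.[p0] < L%:R ->
  exists2 pt : nat -> R, (forall i, 0 <= pt i <= p0) &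
    forall p, 0 <= p <= p0 -> exists i j, [/\ (i < L.+2)%N, (j < L.+2)%N,
      pt i <= p <= pt j, q.[p] - 2 <= q.[pt i] & q.[pt j] <= q.[p] + 2].
Proof.
move=> p00 mono q0 qL.
(* An integer outside the range of [q] gets the dummy point 0. *)
have ivt (i : nat) : exists x, 0 <= x <= p0 /\
    (q.[0] <= i%:R <= q.[p0] -> q.[x] = i%:R).
  have [/andP[h1 h2]|_] := boolP (q.[0] <= i%:R <= q.[p0]); last first.
    by exists 0; rewrite lexx p00.
  have [||x hx /rootP] := @poly_ivt _ (q - i%:R%:P) 0 p0 => //.
    by rewrite !hornerE subr_le0 subr_ge0 h1.
  by rewrite !hornerE => /eqP; rewrite subr_eq0 => /eqP qx; exists x.
have [pt0 hpt0] := choice ivt.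
exists (fun i => if i is i'.+2 then pt0 i' else if i is 1%N then p0 else 0).
  by case=> [|[|i]]; rewrite ?lexx ?p00//; have [] := hpt0 i.
move=> p /andP[pge ple].
have qp0 : q.[0] <= q.[p] by exact: mono.
have qpp : q.[p] <= q.[p0] by exact: mono.
have qpge : 0 <= q.[p] by apply: le_trans qp0.
have /andP[t1 t2] := truncn_itv qpge; set t := Num.truncn q.[p] in t1 t2.
have tL : (t < L)%N by rewrite -(ltr_nat R); lra.
(* The lower neighbour has value [t - 1] rather than [t]: as [q] may be flat, only a strict
   inequality between values yields the order of the points. The endpoint 0 serves when [t - 1] is
   not above the range. *)
have [i [iL hi1 hi2]] : exists i, [/\ (i < L.+2)%N,
    (if i is i'.+2 then pt0 i' else if i is 1%N then p0 else 0) <= p &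
    q.[p] - 2 <= q.[if i is i'.+2 then pt0 i' else if i is 1%N then p0 else 0]].
  have [t0|t0] := leP (t%:R - 1) q.[0].
    exists 0%N; split=> //; move: t2; rewrite -natr1; lra.
  case: t t1 t2 tL t0 => [|t] t1 t2 tL t0; first by lra.
  exists t.+2; split; first by rewrite !ltnS ltnW// ltnW.
    have [/andP[x0 x1] hx] := hpt0 t.
    have qx : q.[pt0 t] = t%:R by apply: hx; move: t1 t0; rewrite -natr1; lra.
    rewrite leNgt; apply/negP => hlt.
    have := mono p (pt0 t) pge (ltW hlt) x1; rewrite qx.
    by move: t1; rewrite -natr1; lra.
  have [/andP[x0 x1] hx] := hpt0 t.
  have -> : q.[pt0 t] = t%:R by apply: hx; move: t1 t0; rewrite -natr1; lra.
  by move: t2; rewrite -!natr1; lra.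
have [j [jL hj1 hj2]] : exists j, [/\ (j < L.+2)%N,
    p <= (if j is i'.+2 then pt0 i' else if j is 1%N then p0 else 0) &
    q.[if j is i'.+2 then pt0 i' else if j is 1%N then p0 else 0] <= q.[p] + 2].
  have [t0|t0] := leP (t.+1%:R) q.[p0]; last first.
    by exists 1%N; split=> //; move: t0 t1; rewrite -natr1; lra.
  have tL1 : (t.+1 < L)%N by rewrite -(ltr_nat R); lra.
  have [/andP[x0 x1] hx] := hpt0 t.+1.
  have qx : q.[pt0 t.+1] = t.+1%:R by apply: hx; lra.
  exists t.+3; split; first by rewrite !ltnS.
    rewrite leNgt; apply/negP => hlt.
    by have := mono _ p x0 (ltW hlt) ple; rewrite qx; lra.
  by rewrite qx; move: t1; rewrite -natr1; lra.
by exists i, j; split=> //; rewrite hi1.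
Qed.

End mean_polynomial.

Section er_process.
Context (d : measure_display) (T : measurableType d) (R : realType).
Variables (P : probability T R) (n : nat) (U : 'I_n.+1 -> 'I_n.+1 -> {RV P >-> R}).
Hypothesis U_uniform : forall i j : 'I_n.+1, (i < j)%N -> uniform01 (U i j).
Hypothesis U_indep : mutually_independent (upper_pairs n.+1)
  (fun e : 'I_n.+1 * 'I_n.+1 => U e.1 e.2).
Local Notation I := (pair_of n.+1).
Local Notation N := (n.+1%:R : R).

Definition process_lam (p : R) (w : T) : R := glam (real_config R (cfg_below U p w)).
Definition mean_lam (p : R) : R :=
  bmean p (fun a : {ffun I -> bool} => glam (real_config R a)).
Local Notation lam := process_lam.
Local Notation g := mean_lam.

Lemma has_mean_lam p : 0 <= p <= 1 -> has_mean P (lam p) (g p).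
Proof.
move=> p01; apply: (has_mean_cfg_below U_uniform U_indep p01) => a.
exact: glam_ge0.
Qed.

Lemma lam_mono p q w : p <= q -> lam p w <= lam q w.
Proof. by move=> pq; apply: glam_mono => e; exact: cfg_below_mono. Qed.

Lemma lam_le p w : lam p w <= N.
Proof.
by apply: glam_le_order => e; rewrite /real_config; case: (_ e); rewrite ?lexx ?ler01.
Qed.

Lemma g_mono p q : 0 <= p -> p <= q -> q <= 1 -> g p <= g q.
Proof.
move=> p0 pq q1; have p01 : 0 <= p <= 1 by lra.
have q01 : 0 <= q <= 1 by lra.
by apply: (has_mean_le (has_mean_lam p01) (has_mean_lam q01)) => w; exact: lam_mono.
Qed.

Lemma g_ge0 p : 0 <= p <= 1 -> 0 <= g p.
Proof. by move=> p01; apply: bmean_ge0 => // a; exact: glam_ge0. Qed.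

Lemma g_le p : 0 <= p <= 1 -> g p <= N.
Proof.
move=> p01; have hN : has_mean P (fun=> N) N by exact: has_mean_cst.
by apply: (has_mean_le (has_mean_lam p01) hN) => w; exact: lam_le.
Qed.

(** Each [p] lies between two of [L + 2] grid points whose means are within 2 of [g p]; monotonicity
    of [lam] transfers the deviation to these points, where the exponential moments are
    controlled. *)
Lemma sparse_bound (p0 : R) (L : nat) : 0 <= p0 <= 1 -> g p0 < L%:R -> (2 <= L)%N ->
  exists2 H : T -> R,
    (forall w p, 0 <= p <= p0 -> `|lam p w - g p| <= H w) &
    mean_le P H (13 * Num.sqrt (ln (2 * L.+2%:R))).
Proof.
move=> p001 gL L2; have p00 : 0 <= p0 by case/andP: p001.
have p01 : p0 <= 1 by case/andP: p001.
have [q qE] := bmean_polynomial (fun a : {ffun I -> bool} => glam (real_config R a)).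
have gE p : g p = q.[p] by exact: qE.
have [|||pt pt01 hpt] := @unit_increment_grid R q p0 L p00.
- by move=> x y x0 xy y0; rewrite -!gE; apply: g_mono => //; exact: le_trans p01.
- by rewrite -gE; apply: g_ge0; rewrite lexx ler01.
- by rewrite -gE.
set Q : R := L.+2%:R; set s := Num.sqrt (ln (2 * Q)).
have Q4 : 4 <= Q by rewrite /Q ler_nat.
have lnQ : 1 <= ln (2 * Q).
  have Q2 : 0 < 2 * Q by lra.
  rewrite -ler_expR lnK ?posrE//.
  have := @expR_le_inv R (1 / 2) ltac:(lra).
  have -> : (1 - 1 / 2)^-1 = 2 :> R by field.
  have -> : expR 1 = expR (1 / 2) * expR (1 / 2) :> R by rewrite -expRD; congr expR; field.
  move=> h; have e0 := expR_ge0 (1 / 2 : R).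
  by have := ler_pM e0 e0 h h; lra.
have s2 : s ^+ 2 = ln (2 * Q) by rewrite sqr_sqrtr//; lra.
have s1 : 1 <= s by rewrite -sqrtr1 ler_wsqrtr.
have s0 : 0 < s by lra.
(* Tuned so that s B = s^2 + 9 s^2: the first part cancels the number 2Q = exp(s^2) of exponentials,
   the second their moment exp(9 s^2). The sum then has mean 1/s, and 2 + 10 s + 1/s <= 13 s. *)
pose B := 10 * s; pose c := s^-1 * expR (- (s * B)).
have c0 : 0 <= c by rewrite mulr_ge0 ?expR_ge0 ?invr_ge0 ?ltW.
(* A linear substitute for a union bound over the grid. *)
have bound x : x <= B + c * expR (s * x).
  have -> : c * expR (s * x) = s^-1 * expR (s * x - s * B).
    by rewrite /c -mulrA -expRD addrC.
  rewrite -lerBlDl ler_pdivlMl//; apply: le_trans (expR_ge1Dx _); lra.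
pose E (i : nat) w := expR (s * (lam (pt i) w - g (pt i))) +
                      expR (s * (g (pt i) - lam (pt i) w)).
have E0 i w : 0 <= E i w by rewrite addr_ge0 ?expR_ge0.
pose H w := 2 + B + c * \sum_(i < L.+2) E i w.
have EH i w : (i < L.+2)%N -> `|lam (pt i) w - g (pt i)| <= B + c * \sum_(i < L.+2) E i w.
  move=> iL; have : E i w <= \sum_(i < L.+2) E i w.
    by rewrite (bigD1 (Ordinal iL))//= lerDl sumr_ge0.
  move=> /(ler_wpM2l c0) hE.
  set x := lam _ _ - _; have Ei : E i w = expR (s * x) + expR (s * - x) by rewrite opprB.
  have h1 := bound x; have h2 := bound (- x); rewrite Ei mulrDr in hE.
  have := mulr_ge0 c0 (expR_ge0 (s * x)); have := mulr_ge0 c0 (expR_ge0 (s * - x)).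
  rewrite ler_norml; move: hE h1 h2 {Ei}; move: (c * expR (s * x)) (c * expR (s * - x)).
  move: (c * _) (B) (x); clear=> x1 x2 x3 x4 x5 h1 h2 h3 h4 h5.
  by apply/andP; split; lra.
exists H => [w p pp0|].
  have [i [j [iL jL /andP[ip pj] gi gj]]] := hpt p pp0.
  rewrite -!gE in gi gj.
  have := EH i w iL; have := EH j w jL; rewrite !ler_norml => /andP[_ hj] /andP[hi _].
  have := lam_mono w ip; have := lam_mono w pj; rewrite /H.
  move: gi gj hi hj; move: (lam p w) (lam (pt i) w) (lam (pt j) w) (g p) (g (pt i)) (g (pt j)).
  move: (c * _) (B); clear=> x1 x2 x3 x4 x5 x6 x7 x8 h1 h2 h3 h4 h5 h6.
  by apply/andP; split; lra.
have mE i : mean_le P (E i) (2 * expR (9 * s ^+ 2)).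
  have pti : 0 <= pt i <= 1 by have /andP[h1 h2] := pt01 i; rewrite h1 (le_trans h2).
  have [h1 h2] := @glam_concentration R n (pt i) s pti (ltW s0).
  rewrite mulr2n mulrDl mul1r; apply: mean_leD.
    exists (bmean (pt i) (fun a : {ffun I -> bool} =>
      expR (s * (glam (real_config R a) - g (pt i))))) => //.
    apply: (has_mean_cfg_below U_uniform U_indep pti
      (G := fun a => expR (s * (glam (real_config R a) - g (pt i))))) => a.
    exact: expR_ge0.
  exists (bmean (pt i) (fun a : {ffun I -> bool} =>
    expR (s * (g (pt i) - glam (real_config R a))))) => //.
  apply: (has_mean_cfg_below U_uniform U_indep pti
    (G := fun a => expR (s * (g (pt i) - glam (real_config R a))))) => a.
  exact: expR_ge0.
have hB : 0 <= 2 + B by rewrite addr_ge0// mulr_ge0// ltW.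
have hH := mean_leD (mean_le_cst P hB) (mean_leZ c0 (mean_le_sum
  (index_enum 'I_L.+2) (Q := xpredT) (fun i _ => mE (i : nat)))).
apply: mean_le_trans hH _.
rewrite sumr_const card_ord -[(2 * expR _) *+ _]mulr_natl -/Q.
have -> : c * (Q * (2 * expR (9 * s ^+ 2))) = s^-1.
  have -> : Q * (2 * expR (9 * s ^+ 2)) = expR (s * B).
    have -> : s * B = s ^+ 2 + 9 * s ^+ 2 by rewrite /B; ring.
    by rewrite expRD s2 lnK ?posrE; [ring|lra].
  by rewrite /c -mulrA -expRD addNr expR0 mulr1.
have : s^-1 <= 1 by rewrite invf_le1.
rewrite /B; lra.
Qed.

End er_process.

(** * The dense regime *)

Section dense_process.
Context (d : measure_display) (T : measurableType d) (R : realType).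
Variables (P : probability T R) (n : nat) (U : 'I_n.+1 -> 'I_n.+1 -> {RV P >-> R}).
Hypothesis n2 : (2 <= n)%N.
Hypothesis U_uniform : forall i j : 'I_n.+1, (i < j)%N -> uniform01 (U i j).
Hypothesis U_indep : mutually_independent (upper_pairs n.+1)
  (fun e : 'I_n.+1 * 'I_n.+1 => U e.1 e.2).
Local Notation I := (pair_of n.+1).
Local Notation N := (n.+1%:R : R).
Local Notation lam := (process_lam U).
Local Notation g := (mean_lam n).

(* The dyadic mesh [1 / m] satisfies [N <= m <= 2 N]. *)
Let K := up_log 2 n.+1.
Let m := (2 ^ K)%N.

Lemma mesh_ge : (n.+1 <= m)%N.
Proof. exact: up_logP. Qed.

Lemma mesh_le : (m <= n.+1.*2)%N.
Proof.
have n1 : (1 < n.+1)%N by rewrite ltnS ltnW.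
have K0 : (0 < K)%N by rewrite up_log_gt0.
have := up_log_gtn (isT : (1 < 2)%N) n1.
by rewrite -/K /m -{2}(prednK K0) expnS mul2n leq_double => /ltnW.
Qed.

Let node (j : nat) : R := j%:R / m%:R.

Lemma mesh_gt0 : 0 < m%:R :> R.
Proof. by rewrite ltr0n expn_gt0. Qed.

Lemma node01 j : (j <= m)%N -> 0 <= node j <= 1.
Proof.
by move=> jm; rewrite divr_ge0//= ler_pdivrMr ?mesh_gt0// mul1r ler_nat.
Qed.

Lemma node_le i j : (i <= j)%N -> node i <= node j.
Proof. by move=> ij; rewrite ler_wpM2r ?invr_ge0// ler_nat. Qed.

Let S (j : nat) (w : T) : R := \sum_e cent (node j) (cfg_below U (node j) w) e.

(* Bounds the largest increment of [S] over dyadic intervals of length [2 ^ - k]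
   through fourth moments, by [norm_le_add_pow4]. *)
Let level (k : nat) (w : T) : R := N * (9 / 10) ^+ k +
  \sum_(i < 2 ^ k) (S (i.+1 * 2 ^ (K - k)) w - S (i * 2 ^ (K - k)) w) ^+ 4 /
                   (N * (9 / 10) ^+ k) ^+ 3.

Lemma pow4_ge0 (x : R) : 0 <= x ^+ 4.
Proof. by rewrite (exprM x 2 2) sqr_ge0. Qed.

(** The ratio 9/10 makes the thresholds summable while its cube exceeds 1/2. Indeed 2^k fourth
    moments of size 2 N^4 4^(-k), divided by the cubed threshold, give 2 N (500/729)^k, still
    summable. *)
Lemma level_mean k : (k <= K)%N ->
  mean_le P (level k) (N * ((9 / 10) ^+ k + 2 * (7 / 10) ^+ k)).
Proof.
move=> kK; set c := N * (9 / 10) ^+ k.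
have N0 : 0 < N by [].
have c0 : 0 < c by rewrite mulr_gt0// exprn_gt0//; lra.
have c3 : 0 <= (c ^+ 3)^-1 by rewrite invr_ge0 exprn_ge0// ltW.
pose b : R := (2 ^+ k)^-1.
have k0 : 0 < (2 : R) ^+ k by rewrite exprn_gt0.
have b01 : 0 <= b <= 1.
  by rewrite /b invr_ge0 ltW//= invf_le1// exprn_ege1// ler1n.
have Nb : 1 <= N ^+ 2 * b.
  rewrite /b ler_pdivlMr// mul1r -!natrX ler_nat.
  apply: (@leq_trans m); first by rewrite leq_exp2l.
  apply: leq_trans mesh_le _; rewrite -muln2 -mulnn leq_mul2l /=.
  by rewrite ltnS (leq_trans _ n2).
have incr i : (i < 2 ^ k)%N -> mean_le P
    (fun w => (S (i.+1 * 2 ^ (K - k)) w - S (i * 2 ^ (K - k)) w) ^+ 4)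
    (2 * (N ^+ 2 * b) ^+ 2).
  move=> ik; set p := node (i * 2 ^ (K - k)); set q := node (i.+1 * 2 ^ (K - k)).
  have iK : (i.+1 * 2 ^ (K - k) <= m)%N.
    by rewrite /m -{2}(subnKC kK) expnD leq_mul2r ik orbT.
  have pq : p <= q by apply: node_le; rewrite leq_mul2r leqnSn orbT.
  have p0 : 0 <= p by have /andP[] := node01 (leq_trans (leq_mul (leqnSn i) (leqnn _)) iK).
  have q1 : q <= 1 by have /andP[] := node01 iK.
  have qpb : q - p = b.
    rewrite /q /p /node -mulrBl -natrB ?leq_mul2r ?leqnSn ?orbT// -mulnBl subSnn mul1n.
    rewrite /m -{2}(subnKC kK) expnD natrM invfM mulrCA !natrX.
    by rewrite mulfV ?mulr1 ?expf_neq0.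
  exists (bmean b (fun a : {ffun I -> bool} => (\sum_e cent b a e) ^+ 4)); last first.
    exact: bmean_increment_pow4_le.
  have := has_mean_cfg U_uniform U_indep (B := `[p, q[%classic) (b := b)
    (G := fun a => (\sum_e cent b a e) ^+ 4).
  have -> : (fun w => (\sum_e cent b (cfg U `[p, q[%classic w) e) ^+ 4) =
      (fun w => (S (i.+1 * 2 ^ (K - k)) w - S (i * 2 ^ (K - k)) w) ^+ 4).
    by apply/funext => w; rewrite /S sum_cent_cfg_increment// qpb.
  apply=> //; last by move=> a; exact: pow4_ge0.
  by rewrite -qpb; exact: uniform_prob_itvco.
have cst : mean_le P (fun=> c) c by apply: mean_le_cst; exact: ltW.
have := mean_leD cst (mean_leZ c3 (mean_le_sum (index_enum 'I_(2 ^ k)) (Q := xpredT)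
  (fun i _ => incr i (ltn_ord i)))).
have -> : (fun w => c + (c ^+ 3)^-1 * \sum_(i < 2 ^ k)
    (S (i.+1 * 2 ^ (K - k)) w - S (i * 2 ^ (K - k)) w) ^+ 4) = level k.
  by apply/funext => w; rewrite /level -/c mulrC mulr_suml.
move=> /mean_le_trans; apply; rewrite sumr_const card_ord mulrDr lerD2l.
rewrite -[(2 * _ ^+ 2) *+ _]mulr_natl natrX /c.
have r0 : (9 / 10 : R) ^+ k != 0 by rewrite expf_neq0//; lra.
have -> : ((N * (9 / 10) ^+ k) ^+ 3)^-1 * (2 ^+ k * (2 * (N ^+ 2 * b) ^+ 2)) =
    N * (2 * (500 / 729) ^+ k).
  have -> : (500 / 729 : R) = 2^-1 / (9 / 10) ^+ 3 by field.
  have -> : (2^-1 / (9 / 10) ^+ 3 : R) ^+ k = (2 ^+ k)^-1 / ((9 / 10) ^+ k) ^+ 3.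
    by rewrite exprMn !exprVn exprAC.
  rewrite /b; move: r0 k0; move: ((9 / 10) ^+ k) (2 ^+ k) => x y x0 y0.
  by field; rewrite x0 !gt_eqF.
have h : (500 / 729 : R) ^+ k <= (7 / 10) ^+ k.
  by apply: lerXn2r; rewrite ?nnegrE; lra.
by apply: ler_wpM2l; [exact: ltW | lra].
Qed.

(** The starting value [S 0] vanishes only almost surely, since the variables may be negative on a
    null set; it is kept through its fourth power, of mean 0. *)
Let chain (w : T) : R := (1 + S 0 w ^+ 4) + \sum_(k < K.+1) level k w.

Lemma chain_mean : mean_le P chain (18 * N).
Proof.
have N1 : 1 <= N by rewrite ler1n.
have p00 : node 0 = 0 by rewrite /node mul0r.
have S0 : mean_le P (fun w => S 0 w ^+ 4) 0.
  exists (bmean 0 (fun a : {ffun I -> bool} => (\sum_e cent 0 a e) ^+ 4)).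
    rewrite /S p00; apply: (has_mean_cfg_below U_uniform U_indep
      (G := fun a => (\sum_e cent 0 a e) ^+ 4)); first by rewrite lexx ler01.
    by move=> a; exact: pow4_ge0.
  apply: le_trans (bmean_centered_sum_pow4 _ _) _; first by rewrite lexx ler01.
  by rewrite mulr0 expr0n mulr0 addr0.
have := mean_leD (mean_leD (mean_le_cst P ler01) S0)
  (mean_le_sum (index_enum 'I_K.+1) (Q := xpredT) (fun k _ => level_mean (ltn_ord k))).
move=> /mean_le_trans; apply; rewrite addr0 -mulr_sumr big_split /= -mulr_sumr.
have h1 := @geometric_sum_le R (9 / 10) K.+1 ltac:(lra).
have h2 := @geometric_sum_le R (7 / 10) K.+1 ltac:(lra).
have e1 : (1 - 9 / 10)^-1 = 10 :> R by field.
have e2 : (1 - 7 / 10)^-1 <= 7 / 2 :> R.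
  by rewrite -div1r ler_pdivrMr; lra.
rewrite e1 in h1; have h3 := le_trans h2 e2.
move: h1 h3; move: (\sum_(i < _) _) (\sum_(i < _) _) => y x h1 h3.
have : N * (x + 2 * y) <= N * 17 by apply: ler_wpM2l; [|lra].
lra.
Qed.

Lemma chain_bound j w : (j <= m)%N -> `|S j w| <= chain w.
Proof.
move=> jm.
have h := @dyadic_chaining R K (fun j => S j w) (level ^~ w).
apply: le_trans (h _ j jm) _ => [k i kK ik|]; last first.
  rewrite /chain lerD2r; apply: le_trans (norm_le_add_pow4 (S 0 w) ltr01) _.
  by rewrite expr1n divr1.
have c0 : 0 < N * (9 / 10) ^+ k by rewrite mulr_gt0// exprn_gt0//; lra.
apply: le_trans (norm_le_add_pow4 _ c0) _; rewrite /level lerD2l.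
rewrite (bigD1 (Ordinal ik))//= lerDl; apply: sumr_ge0 => l _.
by rewrite divr_ge0 ?pow4_ge0// exprn_ge0// ltW.
Qed.

(* The trace exponent [2 k] is a power of 2 with [N <= 2 ^ k], and the regime
   is dense from the node [j0] on, where [N p] is at least [512 (k + 1)^2]. *)
Let s := up_log 2 K.
Let k := (2 ^ s)%N.
Let j0 := (1024 * k.+1 ^ 2)%N.

Let dense (w : T) : R := 5 + 6 / N * chain w +
  \sum_(j < m.+1 | (j0 <= j)%N)
    (cherry_term (node j) (cfg_below U (node j) w) +
     trace_term k (node j) (cfg_below U (node j) w)).

Lemma node_ge j : (j0 <= j)%N -> 512 * k.+1%:R ^+ 2 <= N * node j.
Proof.
move=> jj; rewrite /node [leRHS]mulrA ler_pdivlMr ?mesh_gt0//.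
apply: (@le_trans _ _ (512 * k.+1%:R ^+ 2 * (2 * N))).
  apply: ler_wpM2l; first by apply: mulr_ge0; [exact: ler0n | exact: sqr_ge0].
  by rewrite -natrM ler_nat mul2n mesh_le.
have h : 1024 * k.+1%:R ^+ 2 <= j%:R :> R by rewrite -natrX -natrM ler_nat.
have N0 : 0 <= N by [].
have := ler_wpM2l N0 h; lra.
Qed.

Lemma node_ge1 j : (j0 <= j)%N -> 1 <= N * node j.
Proof.
move=> jj; apply: le_trans (node_ge jj).
have : 1 <= k.+1%:R ^+ 2 :> R by rewrite exprn_ege1// ler1n.
lra.
Qed.

(** The budget is 5 + 108 + 6: the chain gives (6 / N) (18 N), and at most 2N nodes contribute 3 / N
    each. *)
Lemma dense_mean : mean_le P dense 120.
Proof.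
have N0 : 0 < N by [].
have terms (j : 'I_m.+1) : (j0 <= j)%N -> mean_le P
    (fun w => cherry_term (node j) (cfg_below U (node j) w) +
     trace_term k (node j) (cfg_below U (node j) w)) (2 / N + 1 / N).
  move=> jj; have jm : (j <= m)%N by rewrite -ltnS.
  have p01 := node01 jm; have Np := node_ge1 jj.
  have p0 : 0 < node j <= 1.
    have /andP[h1 ->] := p01; rewrite andbT lt_def h1 andbT.
    by apply: contraTneq Np => ->; rewrite mulr0 -ltNge ltr01.
  apply: mean_leD.
    exists (bmean (node j) (@cherry_term R n (node j))); last exact: bmean_cherry_term_le.
    by apply: has_mean_cfg_below => // a; exact: cherry_term_ge0.
  exists (bmean (node j) (@trace_term R n k (node j))).
    by apply: has_mean_cfg_below => // a; exact: trace_term_ge0.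
  apply: bmean_trace_term_le => //; [by rewrite expn_gt0| |exact: node_ge].
  by apply: leq_trans mesh_ge _; rewrite leq_exp2l// /k up_logP.
have c5 : 0 <= 5 :> R by [].
have c6 : 0 <= 6 / N by rewrite divr_ge0.
have := mean_leD (mean_leD (mean_le_cst P c5) (mean_leZ c6 chain_mean))
  (mean_le_sum (index_enum 'I_m.+1) terms).
move=> /mean_le_trans; apply.
have -> : 6 / N * (18 * N) = 108 by field; rewrite gt_eqF.
apply: (@le_trans _ _ (5 + 108 + \sum_(j < m) 3 / N)).
  (* Node 0 lies below [j0], so [m] terms remain instead of [m + 1]. *)
  apply: lerD => //; rewrite big_mkcond big_ord_recl /= add0r.
  apply: ler_sum => j _; rewrite -mulrDl; case: ifP => _; last by rewrite divr_ge0.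
  by apply: ler_wpM2r; [rewrite invr_ge0 ltW|lra].
rewrite sumr_const card_ord -[(3 / N) *+ _]mulr_natl.
have : m%:R * (3 / N) <= (2 * N) * (3 / N).
  apply: ler_wpM2r; first by rewrite divr_ge0.
  by rewrite -natrM ler_nat mul2n mesh_le.
have -> : (2 * N) * (3 / N) = 6 by field; rewrite gt_eqF.
by move: (_ * (3 / N)) => x; lra.
Qed.

Lemma dense_node_bound j w : (j0 <= j)%N -> (j <= m)%N ->
  `|lam (node j) w - N * node j| <= dense w.
Proof.
move=> jj jm; have N0 : 0 < N by [].
apply: le_trans (glam_near_mean _ s (node01 jm) (node_ge1 jj)) _.
rewrite -/k /dense -[leLHS]addrA; apply: lerD.
  rewrite lerD2l mulrAC; apply: ler_wpM2l; first by rewrite divr_ge0.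
  exact: chain_bound.
have jm1 : (j < m.+1)%N by [].
rewrite (bigD1 (Ordinal jm1))//= lerDl; apply: sumr_ge0 => l _.
by rewrite addr_ge0 ?cherry_term_ge0 ?trace_term_ge0.
Qed.

Lemma node_step j : N * node j.+1 <= N * node j + 1.
Proof.
rewrite /node -[j.+1%:R]natr1 mulrDl mulrDr lerD2l mul1r ler_pdivrMr ?mesh_gt0// mul1r.
by rewrite ler_nat mesh_ge.
Qed.

Lemma dense_near p w : node j0 <= p -> p <= 1 -> `|lam p w - N * p| <= dense w + 1.
Proof.
move=> pj p1; have m0 := mesh_gt0; have N0 : 0 < N by [].
have p0 : 0 <= p by apply: le_trans pj; rewrite /node divr_ge0.
have pm0 : 0 <= p * m%:R by rewrite mulr_ge0.
have /andP[t1 t2] := truncn_itv pm0; set t := Num.truncn _ in t1 t2.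
have tm : (t <= m)%N.
  by rewrite -(ler_nat R); apply: le_trans t1 _; rewrite ler_piMl// ltW.
have tj : (j0 <= t)%N.
  rewrite truncn_ge_nat//; move: pj; rewrite /node ler_pdivrMr//.
have tp : node t <= p by rewrite /node ler_pdivrMr.
have ht := dense_node_bound w tj tm; have hl := lam_mono U w tp.
have Ntp : N * node t <= N * p by apply: ler_wpM2l => //; exact: ltW.
have pt : N * p <= N * node t + 1.
  apply: le_trans (node_step t); apply: ler_wpM2l; first exact: ltW.
  by rewrite /node ler_pdivlMr// ltW.
(* At the last node there is no right neighbour on the grid, but then p = 1 is itself the node. *)
have [e|tm'] := eqVneq t m.
  have e1 : p = node t.
    apply/eqP; rewrite eq_le tp andbT; apply: le_trans p1 _.
    by rewrite /node e divff// gt_eqF.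
  by rewrite e1; apply: le_trans ht _; rewrite lerDl.
have tm1 : (t < m)%N by rewrite ltn_neqAle tm' tm.
have tp1 : p <= node t.+1 by rewrite /node ler_pdivlMr// ltW.
have ht1 := dense_node_bound w (leqW tj) tm1; have hl1 := lam_mono U w tp1.
have Ntp1 : N * p <= N * node t.+1 by apply: ler_wpM2l => //; exact: ltW.
have st := node_step t.
move: ht ht1; rewrite !ler_norml => /andP[h1 h2] /andP[h3 h4].
move: hl hl1 Ntp pt Ntp1 st h1 h2 h3 h4.
move: (lam p w) (lam (node t) w) (lam (node t.+1) w) (N * p) (N * node t).
move: (N * node t.+1) (dense w); clear=> x1 x2 x3 x4 x5 x6 x7 *.
by apply/andP; split; lra.
Qed.

Lemma mean_lam_near p : node j0 <= p -> p <= 1 -> `|g p - N * p| <= 121.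
Proof.
move=> pj p1; have p0 : 0 <= p by apply: le_trans pj; rewrite /node divr_ge0.
have p01 : 0 <= p <= 1 by rewrite p0.
have hl := has_mean_lam U_uniform U_indep p01.
have [md hd mdle] := dense_mean.
have Np : 0 <= N * p by rewrite mulr_ge0.
have hd1 := has_meanD hd (has_mean_cst P (ler01 : 0 <= 1 :> R)).
have h1 : g p <= md + 1 + N * p.
  apply: (has_mean_le hl (has_meanD hd1 (has_mean_cst P Np))) => w.
  have := dense_near w pj p1; rewrite ler_norml => /andP[_].
  by rewrite lerBlDr.
have h2 : N * p <= md + 1 + g p.
  apply: (has_mean_le (has_mean_cst P Np) (has_meanD hd1 hl)) => w.
  have := dense_near w pj p1; rewrite distrC ler_norml => /andP[_].
  by rewrite lerBlDr.
rewrite ler_norml; move: h1 h2; move: (g p) (N * p) => x y h1 h2.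
by apply/andP; split; lra.
Qed.

(** The regimes meet at [p0], the node [j0] truncated to the grid. The mean there is at most
    [j0 + 121]: when [j0 <= m] by [mean_lam_near], and otherwise by the trivial bound N <= m < j0.
    In the dense part 242 = 120 + 122, with 1 from [dense_near] and 121 from [mean_lam_near]. *)
Lemma process_bound : exists2 H : T -> R,
  (forall w p, 0 <= p <= 1 -> `|lam p w - g p| <= H w) &
  mean_le P H (13 * Num.sqrt (ln (2 * (j0 + 124)%:R)) + 242).
Proof.
have N0 : 0 < N by []; have m0 := mesh_gt0.
set p0 := node (minn j0 m).
have p001 : 0 <= p0 <= 1 by apply: node01; rewrite geq_minr.
have gL : g p0 < (j0 + 122)%:R.
  have [jm|mj] := leqP j0 m; last first.
    apply: le_lt_trans (g_le U_uniform U_indep p001) _.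
    rewrite ltr_nat; apply: leq_ltn_trans mesh_ge _; apply: leq_trans mj _.
    exact: leq_addr.
  have p0E : p0 = node j0 by rewrite /p0 (minn_idPl jm).
  have h1 : N * p0 <= j0%:R.
    rewrite p0E /node mulrC mulrAC ler_pdivrMr//; apply: ler_wpM2l => //.
    by rewrite ler_nat mesh_ge.
  have := @mean_lam_near p0; rewrite {1}p0E lexx => /(_ isT).
  have /andP[_ p01] := p001 => /(_ p01); rewrite ler_norml => /andP[_].
  by rewrite natrD; move: h1; move: (g p0) (N * p0) (j0%:R : R) => x y z; lra.
have L2 : (2 <= j0 + 122)%N by rewrite addnC.
have [Hs hs ms] := sparse_bound U_uniform U_indep p001 gL L2.
exists (fun w => Hs w + (dense w + 122)) => [w p p01|].
  have s0 := mean_le_ge0 ms w; have d0 := mean_le_ge0 dense_mean w.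
  have [pp|/ltW pp] := leP p p0.
    have pp0 : 0 <= p <= p0 by case/andP: p01 => ->.
    apply: le_trans (hs w p pp0) _; rewrite lerDl addr_ge0//.
  have p1 : p <= 1 by case/andP: p01.
  have [mj|jm] := leqP m j0.
    have p0E : p0 = 1 by rewrite /p0 (minn_idPr mj) /node divff// gt_eqF.
    have pp0 : 0 <= p <= p0 by rewrite p0E.
    apply: le_trans (hs w p pp0) _; rewrite lerDl addr_ge0//.
  have pj : node j0 <= p by move: pp; rewrite /p0 (minn_idPl (ltnW jm)).
  have := dense_near w pj p1; have := mean_lam_near pj p1.
  rewrite !ler_norml => /andP[h1 h2] /andP[h3 h4].
  move: s0 d0 h1 h2 h3 h4; move: (Hs w) (dense w) (lam p w) (g p) (N * p).
  by move=> x1 x2 x3 x4 x5 *; apply/andP; split; lra.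
have c122 : 0 <= 122 :> R by [].
have := mean_leD ms (mean_leD dense_mean (mean_le_cst P c122)).
move=> /mean_le_trans; apply.
rewrite (_ : (j0 + 122).+2 = (j0 + 124)%N); last by rewrite -!addnS.
by rewrite lerD2l; lra.
Qed.

End dense_process.

(** * Conclusion *)

Section iterated_logarithm.
Variable R : realType.

Lemma expR1_lt3 : expR 1 < 3 :> R.
Proof.
have h : expR (8^-1) <= 8 / 7 :> R.
  by apply: le_trans (expR_le_inv _) _; [lra | rewrite le_eqVlt; apply/orP; left; apply/eqP; field].
have e0 := expR_ge0 (8^-1 : R).
have -> : expR 1 = expR (8^-1) ^+ 8 :> R.
  by rewrite -expRM_natl; congr expR; field.
apply: (@le_lt_trans _ _ ((8 / 7) ^+ 8)); first by rewrite lerXn2r ?nnegrE//; lra.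
by rewrite !exprS expr0; lra.
Qed.

Lemma ln3_gt1 : 1 < ln 3 :> R.
Proof. by rewrite -ltr_expR lnK ?posrE// expR1_lt3. Qed.

Lemma ln2_ge_half : 1 / 2 <= ln 2 :> R.
Proof.
rewrite -ler_expR lnK ?posrE//; apply: le_trans (expR_le_inv _) _; first lra.
by rewrite le_eqVlt; apply/orP; left; apply/eqP; field.
Qed.

Lemma up_log2_le n : (2 <= n)%N -> (up_log 2 n.+1)%:R <= 3 * ln n.+1%:R :> R.
Proof.
move=> n2; set K := up_log 2 _.
have n1 : (1 < n.+1)%N by rewrite ltnS ltnW.
have l1 : 1 <= ln n.+1%:R :> R.
  apply: ltW; apply: lt_le_trans ln3_gt1 _.
  by rewrite ler_ln ?posrE// ler_nat ltnS.
have K0 : (0 < K)%N by rewrite up_log_gt0.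
have h := up_log_gtn (isT : (1 < 2)%N) n1; rewrite -/K in h.
have : K.-1%:R * ln 2 <= ln n.+1%:R :> R.
  rewrite mulr_natl -lnXn// ler_ln ?posrE ?exprn_gt0//.
  by rewrite -natrX ler_nat ltnW.
have -> : K%:R = K.-1%:R + 1 :> R by rewrite natr1 prednK.
have : 0 <= K.-1%:R :> R by [].
have := ln2_ge_half; move: (K.-1%:R : R) (ln 2 : R) (ln n.+1%:R : R) l1.
by move=> x y z *; nra.
Qed.

(** Rounding up to a power of 2 gives k + 1 <= 2 K <= 6 ln N, and 2 (1024 * 36 + 124) is below
    50^3. *)
Lemma iterated_log_le (n : nat) : (2 <= n)%N ->
  (2 * ((1024 * (2 ^ up_log 2 (up_log 2 n.+1)).+1 ^ 2)%N + 124)%:R : R) <=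
  50 ^+ 3 * ln n.+1%:R ^+ 2.
Proof.
move=> n2; have hK := up_log2_le n2; set K := up_log 2 n.+1 in hK *.
have K1 : (1 < K)%N.
  by apply: leq_trans (leq_up_log 2 (_ : 3 <= n.+1)%N); rewrite ?ltnS.
have s0 : (0 < up_log 2 K)%N by rewrite up_log_gt0.
have h := up_log_gtn (isT : (1 < 2)%N) K1.
have kK : ((2 ^ up_log 2 K).+1 <= 2 * K)%N.
  by rewrite -(prednK s0) expnS ltn_pmul2l.
have l1 : 1 <= ln n.+1%:R :> R.
  apply: ltW; apply: lt_le_trans ln3_gt1 _.
  by rewrite ler_ln ?posrE// ler_nat ltnS.
rewrite natrD natrM natrX; move: kK; rewrite -(ler_nat R) natrM.
have : 0 <= (2 ^ up_log 2 K).+1%:R :> R by [].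
move: ((2 ^ up_log 2 K).+1%:R : R) (K%:R : R) (ln n.+1%:R : R) hK l1.
move=> x y z hy hz x0 hx.
have h1 : x <= 6 * z by lra.
have h2 : x ^+ 2 <= 36 * z ^+ 2.
  have -> : 36 * z ^+ 2 = (6 * z) ^+ 2 by ring.
  by rewrite lerXn2r// nnegrE; lra.
have h3 : 1 <= z ^+ 2 by rewrite exprn_ege1.
lra.
Qed.

(** With at least three vertices, ln ln N >= ln ln 3 > 0, so the additive ln(50^3) is absorbed into
    a multiple of ln ln N. The 242 is absorbed as well because the square root is at least 1, whence
    255 = 13 + 242. *)
Lemma sqrt_iterated_log_bound : exists C : R, forall n, (2 <= n)%N ->
  13 * Num.sqrt (ln (2 * ((1024 * (2 ^ up_log 2 (up_log 2 n.+1)).+1 ^ 2)%N + 124)%:R))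
    + 242 <= C * Num.sqrt (ln (ln n.+1%:R)).
Proof.
have c0 : 0 < ln (ln 3) :> R by rewrite ln_gt0// ln3_gt1.
have L0 : 0 <= ln (50 ^+ 3) / ln (ln 3) :> R.
  by apply: divr_ge0 (ltW c0); apply: ln_ge0; rewrite exprn_ege1// ler1n.
pose A : R := ln (50 ^+ 3) / ln (ln 3) + 2.
exists (255 * Num.sqrt A) => n n2; have hx := iterated_log_le n2.
set x : R := 2 * _ in hx *.
have x3 : 3 <= x by rewrite /x -natrM ler_nat mulnDr addnC.
clearbody x.
have ln1x : 1 <= ln x.
  by apply: ltW; apply: lt_le_trans ln3_gt1 _; rewrite ler_ln ?posrE//; lra.
have l3 : ln 3 <= ln n.+1%:R :> R by rewrite ler_ln ?posrE// ler_nat ltnS.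
have l31 := ln3_gt1; set l := ln n.+1%:R in hx l3 *.
clearbody l; have l0 : 0 < l by lra.
have x0 : 0 < x by lra.
have c50 : 0 < 50 ^+ 3 :> R by rewrite exprn_gt0.
have l2 : 0 < l ^+ 2 by rewrite exprn_gt0.
have lnl : ln (ln 3) <= ln l by rewrite ler_ln ?posrE//; lra.
have hA : ln x <= A * ln l.
  have : ln x <= ln (50 ^+ 3 * l ^+ 2).
    by rewrite ler_ln ?posrE// mulr_gt0.
  rewrite lnM ?posrE// [ln (l ^+ 2)]lnXn//.
  rewrite -[ln l *+ 2]mulr_natl => /le_trans; apply.
  rewrite /A [leRHS]mulrDl lerD2r.
  apply: le_trans (ler_wpM2l L0 lnl).
  by rewrite divfK ?gt_eqF.
have A0 : 0 <= A by rewrite addr_ge0.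
have s1 : 1 <= Num.sqrt (ln x) by rewrite -sqrtr1 ler_wsqrtr.
have : Num.sqrt (ln x) <= Num.sqrt A * Num.sqrt (ln l).
  by rewrite -sqrtrM// ler_wsqrtr.
rewrite -mulrA; move: s1; move: (Num.sqrt (ln x)) (Num.sqrt A * _) => u v.
lra.
Qed.

End iterated_logarithm.

Local Open Scope classical_set_scope.

Theorem proposition1 (R : realType) :
  exists C : R,
    forall n : nat, (3 <= n)%N ->
    forall (d : measure_display) (T : measurableType d) (P : probability T R)
      (U : 'I_n -> 'I_n -> {RV P >-> R}),
    (forall i j : 'I_n, (i < j)%N -> uniform01 (U i j)) ->
    mutually_independent (upper_pairs n)
      (fun e : 'I_n * 'I_n => U e.1 e.2) ->
    (\int[P]_w ereal_sup
       [set `|(er_lambda U p w)%:E - 'E_P[er_lambda U p]| | p in `[0%R, 1%R]]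
     <= (C * Num.sqrt (ln (ln n%:R)))%:E)%E.
Proof.
have [C hC] := sqrt_iterated_log_bound R.
exists C => -[//|n] n2 d T P U U_uniform U_indep.
have n2' : (2 <= n)%N by [].
have [H hH [m hm mle]] := process_bound n2' U_uniform U_indep.
have [_ H0 intH] := hm.
have mean_p p : 0 <= p <= 1 -> 'E_P[er_lambda U p]%E = (mean_lam n p)%:E.
  move=> p01; have [_ _ <-] := has_mean_lam U_uniform U_indep p01.
  rewrite unlock; apply: eq_integral => w _; rewrite er_lambdaE.
  by [].
apply: (@le_trans _ _ (\int[P]_w (H w)%:E)%E); last first.
  by rewrite intH lee_fin; apply: le_trans (hC n n2').
apply: le_integral_nonmeasurable => w.
  (* The value at p = 0 witnesses that the supremum is nonnegative, as comparison of integrals of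
     possibly nonmeasurable functions requires. *)
  apply: ereal_sup_ge; exists `|(er_lambda U 0 w)%:E - 'E_P[er_lambda U 0]|%E.
    by exists 0 => //=; rewrite in_itv /= lexx ler01.
  exact: abse_ge0.
apply: ge_ereal_sup => _ [p /= + <-]; rewrite in_itv /= => p01.
rewrite mean_p// -EFinB lee_fin er_lambdaE.
exact: hH.
Qed.
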